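(* Let $\mathcal{H}$ be a real Hilbert space and $M:\mathcal{H}\to\mathcal{H}$ a monotone and continuous operator with $\mathrm{Zer}\,M\neq\emptyset$. Let $s_0\ge0$, $z_0\in\mathcal{H}$, let $\beta,\delta:[s_0,+\infty)\to(0,+\infty)$ be continuously differentiable functions satisfying $$\lim_{s\to+\infty}\frac{\delta(s)}{\beta(s)}=0,\qquad\int_{s_0}^{+\infty}\delta(s)\,ds=+\infty,\qquad\int_{s_0}^{+\infty}\beta(s)\,ds=+\infty,$$ and let $z:[s_0,+\infty)\to\mathcal{H}$ be the trajectory solution of $$\dot z(s)+\beta(s)M(z(s))+\delta(s)z(s)=0,\qquad z(s_0)=z_0 .$$ Assume that, in addition, $\beta$ and $\delta$ satisfy either $$\int_{s_0}^{+\infty}\left|\left[\frac{d}{ds}\left(\frac{\delta}{\beta}\right)\right](s)\right|ds<+\infty$$ or $$\lim_{s\to+\infty}\frac{1}{\beta(s)}\left|\frac{\dot\delta(s)}{\delta(s)}-\frac{\dot\beta(s)}{\beta(s)}\right|=0 .$$ Then $z(s)$ converges strongly to the minimum norm solution $\xi_*:=P_{\mathrm{Zer}\,M}(0)$ as $s\to+\infty$.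
   Context: $M$ is monotone if $\langle M(x)-M(y),x-y\rangle\ge 0$ for all $x,y\in\mathcal{H}$. $\mathrm{Zer}\,M:=\{x\in\mathcal{H}: M(x)=0\}$, which is closed and convex; $P_{\mathrm{Zer}\,M}$ is the metric projection onto it. It is assumed that the system admits a unique strong global solution, i.e. a function $z:[s_0,+\infty)\to\mathcal{H}$ that is absolutely continuous on every compact interval $[s_0,S]$, satisfies the equation almost everywhere and the initial condition, and for which moreover $s\mapsto M(z(s))$ is absolutely continuous on every compact interval $[s_0,S]$; this is ''the trajectory solution''. *)

(* Defs.v *)
From HB Require Import structures.
From mathcomp Require Import all_boot all_order all_algebra.
From mathcomp Require Import all_classical all_reals all_analysis.
Set Implicit Arguments.
Unset Strict Implicit.
Unset Printing Implicit Defensive.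
Import Order.TTheory GRing.Theory Num.Theory.
Import numFieldNormedType.Exports.
Local Open Scope classical_set_scope.
Local Open Scope ring_scope.

Definition induces_norm (R : realType) (H : normedModType R)
    (ip : {dot H for idfun}) : Prop :=
  forall x : H, `|x| ^+ 2 = ip x x.

Definition monotone_operator (R : realType) (H : normedModType R)
    (ip : {dot H for idfun}) (M : H -> H) : Prop :=
  forall x y : H, 0 <= ip (M x - M y) (x - y).

Definition Zer (R : realType) (H : normedModType R) (M : H -> H) : set H :=
  [set x | M x = 0].

Definition nearest_point (R : realType) (H : normedModType R)
    (C : set H) (x p : H) : Prop :=
  C p /\ forall y, C y -> `|x - p| <= `|x - y|.

(* A default value when no nearest point exists, which does not happen for a
   nonempty closed convex set in a Hilbert space; the nearest point is then
   also unique. *)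
Definition metric_projection (R : realType) (H : normedModType R)
    (C : set H) (x : H) : H :=
  get (nearest_point C x).

(* At the left endpoint of [D = `[a, +oo[] this is the one-sided derivative,
   at the interior points the usual one. *)
Definition is_derivative_within (R : realType) (D : set R) (f : R -> R)
    (x l : R) : Prop :=
  (f y - f x) / (y - x) @[y --> within D x^'] --> l.

Definition continuously_differentiable_on (R : realType) (D : set R)
    (f : R -> R) : Prop :=
  exists f' : R -> R, {within D, continuous f'} /\
    forall x, D x -> is_derivative_within D f x (f' x).

Definition absolutely_continuous_on (R : realType) (H : normedModType R)
    (a b : R) (f : R -> H) : Prop :=
  forall e : R, 0 < e -> exists2 d : R, 0 < d &
    forall (n : nat) (u v : 'I_n -> R),
      (forall i, [/\ a <= u i, u i <= v i & v i <= b]) ->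
      trivIset setT (fun i => [set` `]u i, v i[]) ->
      \sum_(i < n) (v i - u i) < d ->
      \sum_(i < n) `|f (v i) - f (u i)| < e.

(* Only the values of [z] on `[s0, +oo[ matter. *)
Definition strong_global_solution (R : realType) (H : normedModType R)
    (M : H -> H) (beta delta : R -> R) (s0 : R) (z0 : H) (z : R -> H) : Prop :=
  [/\ forall S, s0 <= S -> absolutely_continuous_on s0 S z,
      forall S, s0 <= S -> absolutely_continuous_on s0 S (M \o z),
      {ae @lebesgue_measure R, forall s, s0 <= s ->
         derivable z s 1 /\
         z^`()%classic s + beta s *: M (z s) + delta s *: z s = 0}
    & z s0 = z0].

Definition trajectory_solution (R : realType) (H : normedModType R)
    (M : H -> H) (beta delta : R -> R) (s0 : R) (z0 : H) (z : R -> H) : Prop :=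
  strong_global_solution M beta delta s0 z0 z /\
  forall w, strong_global_solution M beta delta s0 z0 w ->
    forall s, s0 <= s -> w s = z s.

(* Main.v *)
Require Import Defs.
From HB Require Import structures.
From mathcomp Require Import all_boot all_order all_algebra.
From mathcomp Require Import all_classical all_reals all_analysis.
From mathcomp Require Import measurable_realfun ring lra.
Import Order.TTheory GRing.Theory Num.Theory.
Import numFieldNormedType.Exports.
Local Open Scope classical_set_scope.
Local Open Scope ring_scope.

(** The proof works directly on the trajectory and needs neither the resolvents
    of [M] nor weak topologies.

    Write [eps = delta / beta] and [w s = M (z s) + eps s *: z s], so that the
    equation reads [z' = - beta *: w].  Each step below leads, possibly after
    multiplication by an integrating factor, to a differential inequality
    [F' <= delta * (c - F)]; its solutions are eventually below [c + eta] for
    every [eta > 0], because the integral of [delta] diverges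
    ([gronwall_limsup]).

    - For a zero [xi] of [M], monotonicity gives
      [(`|z - xi| ^+ 2)' <= - 2 * delta * ip z (z - xi)
                         <= delta * (`|xi| ^+ 2 - `|z - xi| ^+ 2)],
      so the trajectory is bounded ([trajectory_bounded]), say by [C].
    - Formally [w' = (M \o z)' + eps' *: z + eps *: z'] with
      [0 <= ip (M \o z)' z' = - beta * ip (M \o z)' w], hence
      [(`|w| ^+ 2)' <= - 2 * delta * `|w| ^+ 2 + 2 * `|eps'| * C * `|w|].
      Either hypothesis on [beta] and [delta] absorbs the last term: since
      [eps' / eps = delta' / delta - beta' / beta], the second one says that
      [`|eps'|] is negligible compared with [delta], while under the first one
      [`|eps'|] is integrable.  Thus [w], and with it [M \o z], tends to [0]
      ([residual_vanishing_of_ratio], [residual_vanishing_of_variation]).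
    - Bounded points where [M] is small nearly satisfy the variational
      inequality [0 <= ip xi (x - xi)] of the minimum norm zero [xi]
      ([min_norm_zero]).  Hence [- eta <= ip xi (z - xi)] eventually, so
      [(`|z - xi| ^+ 2)' <= 2 * delta * (eta - `|z - xi| ^+ 2)] and
      [`|z - xi|] tends to [0] ([trajectory_cvg]).

    The function [M \o z] is only known to be absolutely continuous; its
    differentiability almost everywhere, a form of the Radon-Nikodym property,
    is avoided.  All derivatives are replaced by [upper_slope], a one-sided
    bound on the increments of a real function over small intervals around a
    point, where the error may be a small multiple of
    [Q u v = `|z v - z u| + `|M (z v) - M (z u)| + (v - u)].  Such errors are
    harmless, since the sums of [Q] over families of disjoint intervals are
    bounded, and small if the total length is small, which handles exceptional
    null sets: a function that is Lipschitz continuous with respect to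
    [Q] and has nonpositive upper slopes almost everywhere is nonincreasing
    ([upper_slope_nonincreasing]). *)

(** * Real inner products *)

Section InnerProduct.
Context {R : realType} {H : normedModType R} {ip : {dot H for idfun}}.
Implicit Types (x y u v : H) (a : R).

Lemma ipC x y : ip x y = ip y x.
Proof. by have := @hermC _ _ _ _ ip x y; rewrite /= expr0 mul1r. Qed.

Lemma ipDl x y u : ip (x + y) u = ip x u + ip y u.
Proof. by rewrite linearDl. Qed.

Lemma ipDr u x y : ip u (x + y) = ip u x + ip u y.
Proof. by rewrite ipC ipDl ipC [ip y u]ipC. Qed.

Lemma ipZl a x u : ip (a *: x) u = a * ip x u.
Proof. by rewrite linearZl_LR. Qed.

Lemma ipZr a u x : ip u (a *: x) = a * ip u x.
Proof. by rewrite ipC ipZl ipC. Qed.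

Lemma ipNl x u : ip (- x) u = - ip x u.
Proof. by rewrite -scaleN1r ipZl mulN1r. Qed.

Lemma ipNr u x : ip u (- x) = - ip u x.
Proof. by rewrite ipC ipNl ipC. Qed.

Lemma ipBl x y u : ip (x - y) u = ip x u - ip y u.
Proof. by rewrite ipDl ipNl. Qed.

Lemma ipBr u x y : ip u (x - y) = ip u x - ip u y.
Proof. by rewrite ipDr ipNr. Qed.

Definition ipE := (ipDl, ipDr, ipBl, ipBr, ipNl, ipNr, ipZl, ipZr).

Hypothesis ip_norm : induces_norm ip.

Lemma ip_ge0 x : 0 <= ip x x.
Proof. by rewrite -ip_norm exprn_ge0. Qed.

Lemma cauchy_schwarz x y : `|ip x y| <= `|x| * `|y|.
Proof.
have [->|y0] := eqVneq y 0.
  by rewrite -(scale0r (0 : H)) ipZr mul0r !normr0.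
have yy : 0 < ip y y by rewrite -ip_norm exprn_gt0 ?normr_gt0.
have := ip_ge0 (ip y y *: x - ip x y *: y).
rewrite !ipE [ip y x]ipC => h.
have {}h : 0 <= ip y y * (ip x x * ip y y - ip x y ^+ 2) by lra.
rewrite pmulr_rge0// subr_ge0 -!ip_norm -exprMn in h.
by rewrite -(@ler_pXn2r _ 2) ?nnegrE ?mulr_ge0// real_normK ?num_real.
Qed.

Lemma ip_le x y : ip x y <= `|x| * `|y|.
Proof. exact: le_trans (ler_norm _) (cauchy_schwarz _ _). Qed.

Lemma ip_geN x y : - (`|x| * `|y|) <= ip x y.
Proof. by have := cauchy_schwarz x y; rewrite ler_norml => /andP[]. Qed.

Lemma sqr_normD x y : `|x + y| ^+ 2 = `|x| ^+ 2 + 2 * ip x y + `|y| ^+ 2.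
Proof. by rewrite !ip_norm !ipE [ip y x]ipC; ring. Qed.

Lemma sqr_normB x y : `|x - y| ^+ 2 = `|x| ^+ 2 - 2 * ip x y + `|y| ^+ 2.
Proof. by rewrite sqr_normD ipNr normrN; ring. Qed.

(** A difference of squared norms factors through the inner product. *)
Lemma sqr_norm_sub x y : `|x| ^+ 2 - `|y| ^+ 2 = ip (x + y) (x - y).
Proof. by rewrite !ip_norm !ipE [ip y x]ipC; ring. Qed.

(** Uniqueness of the point of minimal norm, by the parallelogram identity. *)
Lemma eq_nearest_point (C : set H) (p q : H) :
    (forall x y, C x -> C y -> C (2^-1 *: (x + y))) ->
  nearest_point C 0 p -> nearest_point C 0 q -> p = q.
Proof.
move=> Cmid [Cp pmin] [Cq qmin].
have /pmin := Cmid _ _ Cp Cq; have := pmin _ Cq; have := qmin _ Cp.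
rewrite !sub0r !normrN => qp pq pm.
have npq : `|p| = `|q| by apply/eqP; rewrite eq_le pq qp.
have : `|p| ^+ 2 <= `|2^-1 *: (p + q)| ^+ 2.
  by rewrite ler_pXn2r ?nnegrE.
rewrite normrZ ger0_norm ?invr_ge0// exprMn sqr_normD -npq => h1.
have : `|p - q| ^+ 2 <= 0.
  rewrite sqr_normB -npq; lra.
rewrite real_exprn_even_le0 ?normr_real//= normr_eq0 subr_eq0.
by move=> /eqP.
Qed.

End InnerProduct.

(** * Minimum norm zeros of monotone operators *)

Section MonotoneOperator.
Context {R : realType} {H : completeNormedModType R} {ip : {dot H for idfun}}.
Hypothesis ip_norm : induces_norm ip.
Context (M : H -> H).
Hypotheses (M_mono : monotone_operator ip M) (M_cont : continuous M).

(** The points [x] at which [M] is almost monotonically related to [0], up to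
    an error controlled by [mu].  These sets are closed and convex, shrink to
    [Zer M] as [mu] decreases to [0], and contain every point of norm at most
    [C] at which [`|M x| <= mu]. *)
Definition almost_zeros (C mu : R) : set H :=
  [set x | forall y, - (mu * (`|y| + C)) <= ip (M y) (y - x)].

Lemma almost_zeros_small (C mu : R) x :
  `|x| <= C -> `|M x| <= mu -> almost_zeros C mu x.
Proof.
move=> xC Mx y; have := M_mono y x; rewrite ipBl => h.
have h1 := ip_geN ip_norm (M x) (y - x).
have h2 : `|y - x| <= `|y| + C.
  by apply: le_trans (ler_normB _ _) _; rewrite lerD2l.
have h3 : `|M x| * `|y - x| <= mu * (`|y| + C) by exact: ler_pM.
lra.
Qed.

Lemma almost_zeros_convex (C mu : R) x y t : 0 <= t <= 1 ->
  almost_zeros C mu x -> almost_zeros C mu y ->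
  almost_zeros C mu (x + t *: (y - x)).
Proof.
move=> /andP[t0 t1] hx hy u; have := hx u; have := hy u.
rewrite !ipE; set a := ip _ u; set b := ip _ x; set c := ip _ y.
set k := mu * _; nra.
Qed.

Lemma almost_zeros_mono (C mu mu' : R) : 0 <= C -> mu <= mu' ->
  almost_zeros C mu `<=` almost_zeros C mu'.
Proof.
move=> C0 mumu x hx y; apply: le_trans (hx y); rewrite lerN2.
by apply: ler_wpM2r => //; exact: addr_ge0.
Qed.

Lemma ip_cvgl (u : H^nat) l y : u n @[n --> \oo] --> l ->
  ip y (u n) @[n --> \oo] --> ip y l.
Proof.
move=> ul; apply/cvgrPdist_lt => e e0.
have y1 : 0 < `|y| + 1 by rewrite ltr_wpDl.
move/cvgrPdist_lt: ul => /(_ (e / (`|y| + 1)) (divr_gt0 e0 y1)).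
apply: filterS => n hn; rewrite -ipBr.
apply: le_lt_trans (cauchy_schwarz ip_norm _ _) _.
apply: (@le_lt_trans _ _ ((`|y| + 1) * `|l - u n|)).
  by apply: ler_wpM2r => //; rewrite lerDl.
by rewrite mulrC -ltr_pdivlMr.
Qed.

Lemma almost_zeros_closed C mu (u : H^nat) l : u n @[n --> \oo] --> l ->
  (\forall n \near \oo, almost_zeros C mu (u n)) -> almost_zeros C mu l.
Proof.
move=> ul hu y; rewrite ipBr.
have h : ip (M y) y - ip (M y) (u n) @[n --> \oo] --> ip (M y) y - ip (M y) l.
  by apply: cvgB; [exact: cvg_cst|exact: ip_cvgl].
rewrite -(cvg_lim _ h)//; apply: limr_ge; first by apply/cvg_ex; eexists; exact: h.
near=> n; have hn : almost_zeros C mu (u n) by near: n.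
by rewrite -ipBr; exact: hn.
Unshelve. all: by end_near. Qed.

Lemma Zer_almost_zeros (C mu : R) x : 0 <= C -> 0 <= mu -> Zer M x ->
  almost_zeros C mu x.
Proof.
move=> C0 mu0 Mx y; have := M_mono y x; rewrite (Mx : M x = 0) subr0.
by apply: le_trans; rewrite oppr_le0 mulr_ge0// addr_ge0.
Qed.

(** Minty's lemma: by continuity of [M] along segments, a point that is
    monotonically related to [0] is a zero. *)
Lemma almost_zeros_Zer (C : R) x : 0 <= C ->
  (forall mu, 0 < mu -> almost_zeros C mu x) -> Zer M x.
Proof.
move=> C0 hx; have hx0 y : 0 <= ip (M y) (y - x).
  apply/ler_addgt0Pl => e e0; have k0 : 0 < `|y| + C + 1.
    by rewrite ltr_wpDl// addr_ge0.
  have := hx _ (divr_gt0 e0 k0) y; set k := `|y| + C in k0 *.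
  have k1 : k / (k + 1) <= 1 by rewrite ler_pdivrMr// mul1r lerDl.
  have : e / (k + 1) * k <= e.
    rewrite mulrAC -mulrA; apply: ler_piMr => //; exact: ltW.
  lra.
rewrite /Zer/=; apply/eqP; apply/negPn/negP => Mx0.
have nMx : 0 < `|M x| by rewrite normr_gt0.
have Mxc : M (x - t *: M x) @[t --> (0:R)] --> M x.
  rewrite -[X in _ --> M X]subr0 -[X in _ --> M (_ - X)](scale0r (M x)).
  apply: continuous_cvg; first exact: M_cont.
  apply: cvgB; first exact: cvg_cst.
  by apply: cvgZr_tmp; exact: cvg_id.
move/cvgrPdist_lt : Mxc => /(_ _ nMx) /nbhs_ballP[d /= d0 hd].
have d2 : 0 < d / 2 by rewrite divr_gt0.
have /= := hd (d / 2); rewrite /ball/= sub0r normrN gtr0_norm//.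
move=> /(_ _); have dd : d / 2 < d by lra.
move=> /(_ dd); set v := M (_ - _) => hv.
have := hx0 (x - (d / 2) *: M x); rewrite -/v addrAC subrr add0r ipNr ipZr.
rewrite oppr_ge0 pmulr_rle0// => h.
have : `|M x| ^+ 2 <= `|M x - v| * `|M x|.
  rewrite ip_norm; apply: le_trans (ip_le ip_norm _ _); rewrite ipBl; lra.
by rewrite expr2 ler_pM2r// leNgt hv.
Qed.

(** Existence of the minimum norm zero [xi], together with a uniform version of
    the variational inequality that characterizes it: the inequality nearly
    holds at all points of norm at most [C] where [M] is small.  Near-minimizers
    of the norm on the shrinking convex sets [almost_zeros C mu] form a Cauchy
    sequence; this takes the place of weak compactness. *)
Lemma min_norm_zero (C : R) : 0 <= C -> Zer M !=set0 ->
  exists xi, nearest_point (Zer M) 0 xi /\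
    forall eta : R, 0 < eta -> exists2 mu : R, 0 < mu &
      forall x, `|x| <= C -> `|M x| <= mu -> - eta <= ip xi (x - xi).
Proof.
move=> C0 [z0 Mz0].
(* [D] is the limit as [mu] decreases to [0] of the distances from [0] to
   [almost_zeros C mu]. *)
pose L := [set r : R | 0 <= r /\ exists2 mu : R, 0 < mu &
  forall x, almost_zeros C mu x -> r <= `|x|].
have L0 : L 0 by split => //; exists 1.
have Lub y : Zer M y -> ubound L `|y|.
  move=> My r [_ [mu mu0]]; apply; apply: Zer_almost_zeros => //; exact: ltW.
have supL : has_sup L by split; [exists 0|exists `|z0|; exact: Lub].
pose D := sup L.
have D0 : 0 <= D by exact: sup_upper_bound supL _ L0.
(* the norm is almost at least [D] on a small enough set of the family *)
have Dlb (e : R) : 0 < e -> exists2 mu : R, 0 < mu &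
    forall x, almost_zeros C mu x -> D ^+ 2 - 2 * D * e <= `|x| ^+ 2.
  move=> e0; have [r [r0 [mu mu0 hmu]] Dr] := sup_adherent e0 supL.
  exists mu => // x /hmu rx; rewrite -/D in Dr; have := normr_ge0 x.
  have [|] := leP e D; nra.
have Dub (mu e : R) : 0 < mu -> 0 < e -> exists x, almost_zeros C mu x /\ `|x| < D + e.
  move=> mu0 e0; apply/not_existsP => h.
  suff /(sup_upper_bound supL) : L (D + e) by rewrite -/D gerDl leNgt e0.
  split; first by rewrite addr_ge0// ltW.
  exists mu => // x hx; rewrite leNgt; apply/negP => xD; exact: (h x).
have invr_gt0n n : 0 < n.+1%:R^-1 :> R by rewrite invr_gt0.
have [u hu] := choice (fun n => Dub _ _ (invr_gt0n n) (invr_gt0n n)).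
have u_near (mu : R) : 0 < mu ->
    \forall n \near \oo, almost_zeros C mu (u n) /\ `|u n| < D + mu.
  move=> mu0; near=> n; have [h1 h2] := hu n.
  have nmu : n.+1%:R^-1 <= mu by apply: ltW; near: n; exact: (near_infty_natSinv_lt (PosNum mu0)).
  split; first by apply: almost_zeros_mono h1.
  by apply: lt_le_trans h2 _; rewrite lerD2l.
have cu : cvg (u n @[n --> \oo]).
  apply/cauchy_cvgP/cauchy_exP => e e0.
  (* The parallelogram identity for two near-minimizers at precision [e'] and
     their midpoint bounds the squared distance by [(16 * D + 4) * e']. *)
  have k0 : 0 < 16 * D + 4 by lra.
  pose e' := Num.min 1 (e ^+ 2 / (2 * (16 * D + 4))).
  have e'0 : 0 < e' by rewrite lt_min ltr01 divr_gt0// ?exprn_gt0// mulr_gt0.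
  have [e'1 e'e] : e' <= 1 /\ e' * (16 * D + 4) < e ^+ 2.
    split; first by rewrite ge_min lexx.
    apply: (@le_lt_trans _ _ (e ^+ 2 / 2)); last first.
      by rewrite ltr_pdivrMr// ltr_pMr ?exprn_gt0// ltr1n.
    by rewrite -ler_pdivlMr// -mulrA -invfM ge_min lexx orbT.
  have [mu mu0 hmu] := Dlb _ e'0.
  pose mu' := Num.min mu e'; have mu'0 : 0 < mu' by rewrite lt_min mu0.
  have near_u := u_near _ mu'0; have [N _ hN] := near_u.
  exists (u N); apply: filterS near_u => n [un un']; rewrite -ball_normE/=.
  have [uN uN'] := hN N (leqnn N).
  have mid : almost_zeros C mu (u N + 2^-1 *: (u n - u N)).
    apply: almost_zeros_convex; first by rewrite invr_ge0 ler0n invf_le1// ler1n.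
    - by apply: almost_zeros_mono uN; rewrite // ge_min lexx.
    - by apply: almost_zeros_mono un; rewrite // ge_min lexx.
  have {mid} := hmu _ mid.
  have -> : u N + 2^-1 *: (u n - u N) = 2^-1 *: (u N + u n).
    rewrite scalerBr scalerDr addrCA addrC; congr (_ + _).
    rewrite -[X in X - _]scale1r -scalerBl; congr (_ *: _); lra.
  rewrite normrZ ger0_norm ?invr_ge0// exprMn (sqr_normD ip_norm) => mid.
  have sq (x : H) : `|x| < D + mu' -> `|x| ^+ 2 <= (D + e') ^+ 2.
    move=> xD; rewrite ler_pXn2r ?nnegrE ?addr_ge0// ?(ltW e'0)//.
    by apply: le_trans (ltW xD) _; rewrite lerD2l ge_min lexx orbT.
  have := sq _ uN'; have := sq _ un' => s1 s2.
  rewrite -(@ltr_pXn2r _ 2) ?nnegrE// ?(ltW e0)// (sqr_normB ip_norm).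
  nra.
have /cvg_ex[xi uxi] := cu.
have xi_az mu : 0 < mu -> almost_zeros C mu xi.
  move=> mu0; apply: almost_zeros_closed uxi _.
  by apply: filterS (u_near _ mu0) => n [].
have Mxi : Zer M xi by apply: almost_zeros_Zer C0 _.
have xiD : `|xi| = D.
  apply/eqP; rewrite eq_le; apply/andP; split; last first.
    by apply: sup_le_ub; [exists 0|exact: Lub].
  apply/ler_addgt0Pr => e e0.
  have nu : `|u n| @[n --> \oo] --> `|xi| by exact: cvg_norm uxi.
  rewrite -(cvg_lim _ nu)//; apply: limr_le.
    by apply/cvg_ex; eexists; exact: nu.
  by apply: filterS (u_near _ e0) => n [_ /ltW].
exists xi; split.
  split => // y My; rewrite !sub0r !normrN xiD.
  by apply: sup_le_ub; [exists 0|exact: Lub].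
move=> eta eta0; pose K := C + D.
have K0 : 0 <= K by rewrite addr_ge0.
(* Convexity gives points [xi + t (x - xi)] of the family for all small [t];
   [t] is fixed by the quadratic term, then [e] by the defect of the norm. *)
pose t := Num.min 1 (eta / (K ^+ 2 + 1)).
have K1 : 0 < K ^+ 2 + 1 by rewrite ltr_wpDl// exprn_ge0.
have t0 : 0 < t by rewrite lt_min ltr01 divr_gt0.
have tK : t * (K ^+ 2 + 1) <= eta by rewrite -ler_pdivlMr// ge_min lexx orbT.
have D1 : 0 < 2 * (D + 1) by rewrite mulr_gt0// ltr_wpDl.
pose e := t * eta / (2 * (D + 1)).
have e0 : 0 < e by rewrite divr_gt0// mulr_gt0.
have eD : e * (2 * (D + 1)) = t * eta by rewrite /e divfK// gt_eqF.
have [mu mu0 hmu] := Dlb _ e0.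
exists mu => // x xC Mx.
have /hmu : almost_zeros C mu (xi + t *: (x - xi)).
  apply: almost_zeros_convex; [|exact: xi_az|exact: almost_zeros_small].
  by rewrite (ltW t0) ge_min lexx.
rewrite (sqr_normD ip_norm) xiD ipZr normrZ (gtr0_norm t0) exprMn => h.
have xK : `|x - xi| ^+ 2 <= K ^+ 2.
  rewrite ler_pXn2r ?nnegrE//; apply: le_trans (ler_normB _ _) _.
  by rewrite xiD lerD2r.
set a := ip _ _ in h *.
have h1 : t ^+ 2 * `|x - xi| ^+ 2 <= t * eta.
  rewrite expr2 -mulrA ler_pM2l//; apply: le_trans tK.
  by rewrite ler_pM2l// (le_trans xK)// lerDl.
have h2 : 0 <= t * (a + eta).
  lra.
by rewrite pmulr_rge0// in h2; lra.
Unshelve. all: by end_near. Qed.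

End MonotoneOperator.

(** * Absolutely continuous interval functions and monotonicity *)

Section RealInduction.
Context {R : realType}.

(** Induction along a segment: a property that crosses every point of the
    segment from left to right locally is carried to the right end. *)
Lemma real_induction (a b : R) (P : R -> Prop) : a <= b -> P a ->
  (forall x, a <= x <= b -> exists2 g, 0 < g & forall u v,
     a <= u -> u <= x -> x <= v -> v <= b -> x - g < u -> v < x + g ->
     P u -> P v) ->
  P b.
Proof.
move=> ab Pa step; pose S := [set x | a <= x <= b /\ P x].
have Sa : S a by rewrite /S/= lexx ab.
have supS : has_sup S by split; [exists a|exists b => x [/andP[]]].
have aS : a <= sup S by exact: sup_upper_bound Sa.
have Sb : sup S <= b by apply: sup_le_ub; [exists a|move=> x [/andP[]]].
have [|g g0 hg] := step (sup S); first by rewrite aS.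
have [u [/andP[au ub] Pu] gu] := sup_adherent g0 supS.
have uS : u <= sup S by apply: (sup_upper_bound supS); split => //; rewrite au.
pose v := Num.min b (sup S + g / 2).
have [Sv vb vg] : [/\ sup S <= v, v <= b & v < sup S + g].
  split; first by rewrite le_min Sb lerDl divr_ge0// ltW.
    by rewrite ge_min lexx.
  by rewrite gt_min; apply/orP; right; rewrite ltrD2l; lra.
have Pv : P v by apply: (hg u) Pu.
have : v <= sup S.
  by apply: (sup_upper_bound supS); split; rewrite // vb (le_trans aS).
rewrite /v ge_min gerDl => /orP[bS|]; last by move=> ?; lra.
by move: Pv; rewrite /v min_l// (le_trans bS)// lerDl divr_ge0// ltW.
Qed.

End RealInduction.

Section IntervalFunction.
Context {R : realType}.
Implicit Types (U : set R) (s : seq (R * R)) (Q : R -> R -> R) (F G : R -> R).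
Notation mu := (@lebesgue_measure R).

Lemma ae_imp (P P' : R -> Prop) : (forall t, P t -> P' t) ->
  {ae mu, forall t, P t} -> {ae mu, forall t, P' t}.
Proof. by move=> PP'; apply: negligibleS => t /= nP' /PP'. Qed.

Lemma negligible_open_cover (N : set R) (e : R) : mu.-negligible N -> 0 < e ->
  exists U, [/\ open U, N `<=` U & (mu U < e%:E)%E].
Proof.
move=> [A [mA A0 NA]] e0.
have Afin : (mu A < +oo)%E by apply: (@le_lt_trans _ _ 0%E) => //; rewrite A0.
have [U [oU AU UA]] := lebesgue_regularity_outer mA Afin e0.
exists U; split => //; first exact: subset_trans AU.
have mU : measurable U by exact: open_measurable.
have UE : U `<=` (U `\` A) `|` A.
  by move=> y Uy; have [|] := pselect (A y); [right|left].
apply: (@le_lt_trans _ _ (mu ((U `\` A) `|` A))).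
  by apply: le_measure; rewrite ?inE//; apply: measurableU => //; exact: measurableD.
apply: le_lt_trans UA; apply: le_trans (measureU2 _ _ _) _ => //.
  exact: measurableD.
by rewrite [X in (_ + X)%E](_ : _ = 0%E) ?adde0.
Qed.

(** A finite family of non-overlapping intervals [(u, v)] of [[a, x]], listed
    from right to left, whose interiors lie in [U]. *)
Fixpoint chain U (a x : R) s : Prop :=
  if s is p :: s' then
    [/\ chain U a p.1 s', p.1 <= p.2, p.2 <= x & `]p.1, p.2[ `<=` U]
  else a <= x.

Definition chain_sum Q s : R := \sum_(p <- s) Q p.1 p.2.

Definition chain_length s : R := \sum_(p <- s) (p.2 - p.1).

Lemma chain_le {U a x s} : chain U a x s -> a <= x.
Proof.
elim: s x => [//|p s IH] x [/= /IH ap pp px _].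
exact: le_trans (le_trans ap pp) px.
Qed.

Lemma chain_sub {U V a b x y s} : U `<=` V -> a <= b -> x <= y ->
  chain U b x s -> chain V a y s.
Proof.
move=> UV ab; elim: s x y => [|p s IH] x y xy /=.
  by move=> bx; exact: le_trans (le_trans ab bx) xy.
move=> [h1 h2 h3 h4]; split => //; first exact: IH h1.
  exact: le_trans xy.
exact: subset_trans UV.
Qed.

Lemma chain_length_le {U a x s} : chain U a x s -> chain_length s <= x - a.
Proof.
rewrite /chain_length; elim: s x => [|p s IH] x /=.
  by rewrite big_nil subr_ge0.
by move=> [/IH h1 h2 h3 _]; rewrite big_cons; lra.
Qed.

Lemma chain_length_measure {U a x s} : measurable U -> chain U a x s ->
  ((chain_length s)%:E <= mu (U `&` `]-oo, x[))%E.
Proof.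
move=> mU; rewrite /chain_length; elim: s x => [|p s IH] x /=.
  by rewrite big_nil measure_ge0.
move=> [/IH h1 h2 h3 h4]; rewrite big_cons EFinD.
apply: (@le_trans _ _ (mu `]p.1, p.2[ + mu (U `&` `]-oo, p.1[))%E).
  apply: leeD => //; rewrite lebesgue_measure_itv/= lte_fin.
  by case: ifPn => //; rewrite -leNgt lee_fin => ?; rewrite subr_le0.
rewrite -measureU//; [|exact: measurableI|].
  apply: le_measure; rewrite ?inE//.
  - by apply: measurableU => //; exact: measurableI.
  - exact: measurableI.
  - move=> y /= [yp|[Uy]].
      split; first exact: h4.
      by move: yp; rewrite /= !in_itv/= => /andP[_ yp]; exact: lt_le_trans h3.
    by rewrite !in_itv/= => yp; split => //; apply: lt_le_trans yp (le_trans h2 h3).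
apply/seteqP; split => y //= [] /=; rewrite !in_itv/= => /andP[py _] [_ yp].
by move: (lt_trans py yp); rewrite ltxx.
Qed.

Lemma chain_bounds {U a x s} (p0 : R * R) : chain U a x s ->
  forall i, (i < size s)%N ->
  [/\ a <= (nth p0 s i).1, (nth p0 s i).1 <= (nth p0 s i).2
    & (nth p0 s i).2 <= x].
Proof.
elim: s x => [//|p s IH] x /= [h1 h2 h3 _] [_|i] /=.
  by split => //; exact: chain_le h1.
rewrite ltnS => /(IH _ h1)[? ? h]; split => //.
exact: le_trans h (le_trans h2 h3).
Qed.

Lemma chain_ordered {U a x s} (p0 : R * R) : chain U a x s ->
  forall i j, (i < j)%N -> (j < size s)%N -> (nth p0 s j).2 <= (nth p0 s i).1.
Proof.
elim: s x => [//|p s IH] x /= [h1 _ _ _] [|i] [|j]//=; rewrite ?ltnS.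
  by move=> _ /(chain_bounds p0 h1)[].
exact: IH h1 i j.
Qed.

(** Absolute continuity of a function of intervals: [Q u v] plays the role of
    an increment [`|f v - f u|]. *)
Definition ac_interval Q a b := forall e : R, 0 < e -> exists2 d : R, 0 < d &
  forall s, chain setT a b s -> chain_length s < d -> chain_sum Q s < e.

Lemma ac_interval_sub {Q a b} a' b' : a <= a' -> b' <= b ->
  ac_interval Q a b -> ac_interval Q a' b'.
Proof.
move=> aa bb hQ e /hQ[d d0 hd]; exists d => // s hs; apply: hd.
exact: chain_sub hs.
Qed.

Lemma ac_intervalD {Q1 Q2 a b} : ac_interval Q1 a b -> ac_interval Q2 a b ->
  ac_interval (fun u v => Q1 u v + Q2 u v) a b.
Proof.
move=> h1 h2 e e0; have e20 : 0 < e / 2 by rewrite divr_gt0.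
have [[d1 d10 hd1] [d2 d20 hd2]] := (h1 _ e20, h2 _ e20).
exists (Num.min d1 d2) => [|s hs]; first by rewrite lt_min d10.
rewrite lt_min => /andP[s1 s2]; rewrite /chain_sum big_split/=.
have := hd1 _ hs s1; have := hd2 _ hs s2; rewrite /chain_sum; lra.
Qed.

Lemma ac_interval_length a b : ac_interval (fun u v => v - u) a b.
Proof. by move=> e e0; exists e. Qed.

Lemma ac_interval_increment {V : normedModType R} {f : R -> V} {a b} :
  absolutely_continuous_on a b f -> ac_interval (fun u v => `|f v - f u|) a b.
Proof.
move=> hf e /hf[d d0 hd]; exists d => // s hs sd.
pose u (i : 'I_(size s)) := (nth (0, 0) s i).1.
pose v (i : 'I_(size s)) := (nth (0, 0) s i).2.
rewrite /chain_sum (big_nth (0, 0)) big_mkord; apply: (hd _ u v).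
- by move=> i; exact: chain_bounds hs _ (ltn_ord i).
- move=> i j _ _ [y []]; rewrite /= !in_itv/= => /andP[u1 v1] /andP[u2 v2].
  apply: val_inj => /=; have [ij|ij|//] := ltngtP i j.
    have := chain_ordered (0, 0) hs _ _ ij (ltn_ord j); rewrite -/(u i) -/(v j).
    by move=> h; move: (lt_le_trans (lt_trans u1 v2) h); rewrite ltxx.
  have := chain_ordered (0, 0) hs _ _ ij (ltn_ord i); rewrite -/(u j) -/(v i).
  by move=> h; move: (lt_le_trans (lt_trans u2 v1) h); rewrite ltxx.
- by move: sd; rewrite /chain_length (big_nth (0, 0)) big_mkord.
Qed.

(** [F] is Lipschitz continuous on [[a, b]] with respect to [Q]: the increments
    of [F] are dominated by a multiple of [Q]. *)
Definition lip_interval {V : normedZmodType R} Q a b (F : R -> V) :=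
  exists K, forall u v, a <= u -> u <= v -> v <= b -> `|F v - F u| <= K * Q u v.

(** The derivative of [F] at [t], taken along intervals [[u, v]] that contain
    [t], is at most [p], up to an error that is small relative to [Q u v]
    instead of [v - u].  The weaker error is harmless after summation, since
    an absolutely continuous [Q] has bounded sums. *)
Definition upper_slope Q F t p := forall eta : R, 0 < eta ->
  exists2 g : R, 0 < g & forall u v,
    t - g < u -> u <= t -> t <= v -> v < t + g ->
    F v - F u <= p * (v - u) + eta * Q u v.

Section Monotonicity.
Context {Q : R -> R -> R}.
Hypothesis Q_ge : forall u v, u <= v -> v - u <= Q u v.

Let Q_ge0 u v : u <= v -> 0 <= Q u v.
Proof. by move=> uv; apply: le_trans (Q_ge _ _ uv); rewrite subr_ge0. Qed.

(* The sums of [Q] over [s1] collect the errors at the good points, those over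
   [s2] the increments across the null set, whose total length is small. *)
Let nonincreasing_short F a b : a <= b -> ac_interval Q a b ->
  lip_interval Q a b F ->
  {ae mu, forall t, a < t -> t < b -> exists2 p, p <= 0 & upper_slope Q F t p} ->
  (forall s, chain setT a b s -> chain_sum Q s <= 1) ->
  F b <= F a.
Proof.
move=> ab acQ [K' hK'] aeF short.
pose K := Num.max 0 K'.
have hK u v : a <= u -> u <= v -> v <= b -> F v - F u <= K * Q u v.
  move=> au uv vb; apply: le_trans (ler_norm _) (le_trans (hK' _ _ au uv vb) _).
  by rewrite ler_wpM2r ?Q_ge0// le_max lexx orbT.
have K0 : 0 <= K by rewrite le_max lexx.
pose good t := a < t -> t < b -> exists2 p, p <= 0 & upper_slope Q F t p.
suff est eta : 0 < eta -> F b - F a <= eta * (1 + K).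
  apply/ler_addgt0Pl => e e0; have K1 : 0 < 1 + K by rewrite ltr_pwDl.
  have := est _ (divr_gt0 e0 K1); rewrite divfK ?gt_eqF//; lra.
move=> eta0; have [d d0 hd] := acQ _ eta0.
have negl1 (x : R) : mu.-negligible [set x].
  by exists [set x]; split => //; exact: lebesgue_measure_set1.
have [U [oU NU Ud]] : exists U, [/\ open U,
    ~` [set t | good t] `|` [set a; b] `<=` U & (mu U < d%:E)%E].
  have : mu.-negligible (~` [set t | good t] `|` [set a; b]).
    apply: negligibleU => //; apply: negligibleU; exact: negl1.
  by move=> /negligible_open_cover/(_ d0)[U [? ? ?]]; exists U.
pose P x := exists s1 s2, [/\ chain setT a x s1, chain U a x s2 &
  F x - F a <= eta * chain_sum Q s1 + K * chain_sum Q s2].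
have [s1 [s2 [cs1 cs2 hF]]] : P b.
  apply: real_induction ab _ _ => [|x /andP[ax xb]].
    exists [::], [::]; split => //=.
    by rewrite /chain_sum !big_nil subrr !mulr0 addr0.
  have [Ux|nUx] := pselect (U x).
    have [g /= g0 hg] := (iffLR (nbhs_ballP _ _) (open_nbhs_nbhs (conj oU Ux))).
    exists g => // u v au ux xv vb gu gv [s1 [s2 [cs1 cs2 hF]]].
    have uv := le_trans ux xv.
    exists s1, ((u, v) :: s2); split => //=.
    - exact: chain_sub cs1.
    - split => // y; rewrite /= in_itv/= => /andP[uy yv]; apply: hg.
      by rewrite /ball/= ltr_distlC; apply/andP; split; lra.
    - have := hK _ _ au uv vb; rewrite /chain_sum big_cons/= in hF *; lra.
  have gx : good x by apply: contrapT => h; apply: nUx; apply: NU; left.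
  have {}ax : a < x.
    rewrite lt_neqAle ax andbT; apply/eqP => ax'.
    by apply: nUx; apply: NU; right; left.
  have {}xb : x < b.
    rewrite lt_neqAle xb andbT; apply/eqP => xb'.
    by apply: nUx; apply: NU; right; right.
  have [p p0 /(_ _ eta0)[g g0 hg]] := gx ax xb.
  exists g => // u v au ux xv vb gu gv [s1 [s2 [cs1 cs2 hF]]].
  have uv := le_trans ux xv.
  exists ((u, v) :: s1), s2; split => //=.
  - exact: chain_sub cs2.
  - have := hg _ _ gu ux xv gv; have : p * (v - u) <= 0.
      by rewrite mulr_le0_ge0// subr_ge0.
    rewrite /chain_sum big_cons/= in hF *; lra.
have h1 := short _ cs1.
have h2 : chain_sum Q s2 < eta.
  apply: hd; first exact: chain_sub cs2.
  rewrite -lte_fin; apply: le_lt_trans (chain_length_measure _ cs2) _.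
    exact: open_measurable.
  apply: le_lt_trans Ud; apply: le_measure; rewrite ?inE//.
  - by apply: measurableI => //; exact: open_measurable.
  - exact: open_measurable.
apply: le_trans hF _; nra.
Qed.

(** An absolutely continuous function with nonpositive derivative almost
    everywhere is nonincreasing. *)
Lemma upper_slope_nonincreasing {F a b} : a <= b -> ac_interval Q a b ->
  lip_interval Q a b F ->
  {ae mu, forall t, a < t -> t < b -> exists2 p, p <= 0 & upper_slope Q F t p} ->
  F b <= F a.
Proof.
move=> ab acQ [K hK] aeF.
have [d d0 hd] := acQ _ ltr01.
apply: (real_induction a b (fun x => F x <= F a)) => // x /andP[ax xb].
(* On an interval of length less than [d] all sums of [Q] are at most [1]. *)
exists (d / 2) => [|u v au ux xv vb gu gv]; first by rewrite divr_gt0.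
apply: le_trans; apply: nonincreasing_short.
- exact: le_trans ux xv.
- exact: ac_interval_sub acQ.
- exists K => u' v' uu' u'v' vv'; apply: hK => //.
    exact: le_trans au uu'.
  exact: le_trans vv' vb.
- move: aeF; apply: ae_imp => t ht ut tv; apply: ht.
    exact: le_lt_trans au ut.
  exact: lt_le_trans tv vb.
- move=> s hs; apply/ltW/hd; first exact: chain_sub hs.
  by apply: le_lt_trans (chain_length_le hs) _; lra.
Qed.

End Monotonicity.
End IntervalFunction.

(** * Calculus of upper slopes *)

Section SlopeCalculus.
Context {R : realType}.
Implicit Types (Q : R -> R -> R) (F G : R -> R).

Lemma lip_intervalD {V : normedZmodType R} {Q a b} {f g : R -> V} :
  lip_interval Q a b f -> lip_interval Q a b g ->
  lip_interval Q a b (fun s => f s + g s).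
Proof.
move=> [K hK] [L hL]; exists (K + L) => u v au uv vb.
rewrite opprD addrACA mulrDl; apply: le_trans (ler_normD _ _) _.
by apply: lerD; [exact: hK|exact: hL].
Qed.

Lemma lip_interval_cst {V : normedZmodType R} {Q a b} (c : V) :
  lip_interval Q a b (fun=> c).
Proof. by exists 0 => *; rewrite subrr normr0 mul0r. Qed.

Lemma ac_interval_lip {V : normedZmodType R} {Q a b} {f : R -> V} :
  (forall u v, u <= v -> 0 <= Q u v) -> ac_interval Q a b ->
  lip_interval Q a b f -> ac_interval (fun u v => `|f v - f u|) a b.
Proof.
move=> Q0 acQ [K hK] e e0; have K1 : 0 < `|K| + 1 by rewrite ltr_wpDl.
have [d d0 hd] := acQ _ (divr_gt0 e0 K1).
exists d => // s hs sd; have := hd _ hs sd; rewrite ltr_pdivlMr// mulrC.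
apply: le_lt_trans; elim: s {sd} b hs hK {acQ hd} => [|p s IH] b hs hK.
  by rewrite /chain_sum !big_nil mulr0.
move: hs => /= [hs p12 pb _].
have ap := chain_le hs.
rewrite /chain_sum !big_cons mulrDr; apply: lerD.
  apply: le_trans (hK _ _ ap p12 pb) _; apply: ler_wpM2r; first exact: Q0.
  by apply: le_trans (ler_norm _) _; rewrite lerDl.
apply: IH hs _ => u v au uv vp; apply: hK => //.
exact: le_trans vp (le_trans p12 pb).
Qed.

Lemma ac_interval_bounded {V : normedZmodType R} {a b} {f : R -> V} : a <= b ->
  ac_interval (fun u v => `|f v - f u|) a b ->
  exists2 B, 0 < B & forall x, a <= x -> x <= b -> `|f x| <= B.
Proof.
move=> ab acf; have [d d0 hd] := acf _ ltr01.
suff [B hB] : exists B, forall x, a <= x -> x <= b -> `|f x| <= B.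
  exists (`|B| + 1) => [|x ax xb]; first by rewrite ltr_wpDl.
  by apply: le_trans (hB _ ax xb) (le_trans (ler_norm _) _); rewrite lerDl.
apply: (real_induction a b
    (fun x => exists B, forall y, a <= y -> y <= x -> `|f y| <= B)) => //.
  exists `|f a| => y ay ya; suff -> : y = a by [].
  by apply/eqP; rewrite eq_le ay ya.
move=> x _; exists (d / 2) => [|u v au ux xv vb gu gv [B hB]].
  by rewrite divr_gt0.
exists (B + 1) => y ay yv; have [yu|uy] := leP y u.
  by apply: le_trans (hB _ ay yu) _; rewrite lerDl.
have : `|f y - f u| < 1.
  have /(_ _ _)/= := hd [:: (u, y)]; rewrite /chain_sum /chain_length !big_seq1/=.
  apply; last lra.
  by split => //; [exact: ltW|exact: le_trans vb].
have := hB _ au (lexx u); have := ler_normD (f y - f u) (f u).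
rewrite subrK; lra.
Qed.

Lemma lip_interval_scale {V : normedModType R} {Q a b} {h : R -> R} {f : R -> V} :
  a <= b -> (forall u v, u <= v -> 0 <= Q u v) -> ac_interval Q a b ->
  lip_interval Q a b h -> lip_interval Q a b f ->
  lip_interval Q a b (fun s => h s *: f s).
Proof.
move=> ab Q0 acQ lh lf.
have [B B0 hB] := ac_interval_bounded ab (ac_interval_lip Q0 acQ lh).
have [C C0 hC] := ac_interval_bounded ab (ac_interval_lip Q0 acQ lf).
move: lh lf => [K hK] [L hL]; exists (B * L + C * K) => u v au uv vb.
have -> : h v *: f v - h u *: f u = h v *: (f v - f u) + (h v - h u) *: f u.
  by rewrite scalerBr scalerBl addrA subrK.
apply: le_trans (ler_normD _ _) _; rewrite !normrZ mulrDl; apply: lerD.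
  rewrite -mulrA; apply: ler_pM => //; last exact: hL.
  exact: hB (le_trans au uv) vb.
rewrite mulrC -mulrA; apply: ler_pM => //; last exact: hK.
exact: hC au (le_trans uv vb).
Qed.

Lemma lip_intervalM {Q a b} {h f : R -> R} :
  a <= b -> (forall u v, u <= v -> 0 <= Q u v) -> ac_interval Q a b ->
  lip_interval Q a b h -> lip_interval Q a b f ->
  lip_interval Q a b (fun s => h s * f s).
Proof. exact: (@lip_interval_scale R^o). Qed.

Lemma lip_interval_sqr_norm {V : normedModType R} {Q a b} {f : R -> V} :
  a <= b -> (forall u v, u <= v -> 0 <= Q u v) -> ac_interval Q a b ->
  lip_interval Q a b f -> lip_interval Q a b (fun s => `|f s| ^+ 2).
Proof.
move=> ab Q0 acQ lf; have ln : lip_interval Q a b (fun s => `|f s|).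
  move: lf => [K hK]; exists K => u v au uv vb.
  exact: le_trans (ler_dist_dist _ _) (hK _ _ au uv vb).
exact: (lip_intervalM ab Q0 acQ ln ln).
Qed.

Lemma cvg_sqr_norm {V : normedModType R} {f : R -> V} {t : R} :
  f x @[x --> t] --> f t -> `|f x| ^+ 2 @[x --> t] --> `|f t| ^+ 2.
Proof.
move=> /cvg_norm h; under eq_cvg do rewrite expr2.
by rewrite expr2; exact: cvgM.
Qed.

Lemma straddle_continuous {V : normedModType R} {f : R -> V} {t} :
  f x @[x --> t] --> f t -> forall eta, 0 < eta ->
  exists2 g : R, 0 < g & forall u, t - g < u -> u < t + g -> `|f u - f t| <= eta.
Proof.
move=> ft eta eta0; move/cvgrPdist_le : ft => /(_ _ eta0)/nbhs_ballP[g /= g0 hg].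
exists g => // u gu ug; rewrite distrC; apply: hg.
by rewrite /ball/= ltr_distlC; apply/andP; split; lra.
Qed.

(** Straddle lemma: difference quotients over intervals containing [t], not
    only those with [t] as an endpoint, approximate the derivative. *)
Lemma straddle_derive {V : normedModType R} {f : R -> V} {t : R} {l : V} :
  is_derive t 1 f l -> forall eta, 0 < eta ->
  exists2 g : R, 0 < g & forall u v, t - g < u -> u <= t -> t <= v -> v < t + g ->
    `|f v - f u - (v - u) *: l| <= eta * (v - u).
Proof.
move=> [df dfl] eta eta0.
have : h^-1 *: (f (h *: 1 + t) - f t) @[h --> 0^'] --> l.
  by rewrite -dfl; exact: df.
move/cvgrPdist_le => /(_ _ eta0); rewrite near_withinE => /nbhs_ballP[g /= g0 hg].
have est x : `|x - t| < g -> `|f x - f t - (x - t) *: l| <= eta * `|x - t|.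
  have [->|xt] := eqVneq x t; first by rewrite !subrr scale0r subr0 !normr0 mulr0.
  move=> xg; have xt0 : x - t != 0 by rewrite subr_eq0.
  have /= := hg (x - t); rewrite /ball/= sub0r normrN => /(_ xg xt0).
  rewrite [_ *: 1]mulr1 subrK => h.
  have -> : f x - f t - (x - t) *: l =
      - (x - t) *: (l - (x - t)^-1 *: (f x - f t)).
    by rewrite scaleNr scalerBr scalerA divff// scale1r opprB.
  by rewrite normrZ normrN mulrC ler_wpM2r.
exists g => // u v gu ut tv vg.
have hu : `|u - t| = t - u by rewrite distrC ger0_norm ?subr_ge0.
have hv : `|v - t| = v - t by rewrite ger0_norm ?subr_ge0.
have hu' := est u; have hv' := est v.
have -> : f v - f u - (v - u) *: l =
    (f v - f t - (v - t) *: l) - (f u - f t - (u - t) *: l).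
  have -> : v - u = (v - t) - (u - t) by ring.
  rewrite scalerBl !opprD !opprK !addrA.
  by rewrite [RHS](ACl (1*4*3*6*(2*5)))/= addNr addr0.
apply: le_trans (ler_normB _ _) _.
rewrite hu in hu'; rewrite hv in hv'.
have : `|f u - f t - (u - t) *: l| <= eta * (t - u) by apply: hu'; lra.
have : `|f v - f t - (v - t) *: l| <= eta * (v - t) by apply: hv'; lra.
lra.
Qed.

Section Slopes.
Context {Q : R -> R -> R}.
Hypothesis Q_ge : forall u v, u <= v -> v - u <= Q u v.

Lemma upper_slope_le {F t} p q : p <= q -> upper_slope Q F t p ->
  upper_slope Q F t q.
Proof.
move=> pq hF eta /hF[g g0 hg]; exists g => // u v gu ut tv vg.
apply: le_trans (hg _ _ gu ut tv vg) _; rewrite lerD2r; apply: ler_wpM2r => //.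
by rewrite subr_ge0 (le_trans ut).
Qed.

Lemma upper_slope_eq {F G t p} : F =1 G -> upper_slope Q F t p ->
  upper_slope Q G t p.
Proof. by move=> /funext ->. Qed.

Lemma upper_slopeD {F G t p q} : upper_slope Q F t p -> upper_slope Q G t q ->
  upper_slope Q (fun s => F s + G s) t (p + q).
Proof.
move=> hF hG eta eta0; have e2 : 0 < eta / 2 by rewrite divr_gt0.
have [[g g0 hg] [k k0 hk]] := (hF _ e2, hG _ e2).
exists (Num.min g k) => [|u v]; first by rewrite lt_min g0.
rewrite !ltrBlDr -!ltrBlDl !lt_min => /andP[gu ku] ut tv /andP[vg vk].
have h1 : F v - F u <= p * (v - u) + eta / 2 * Q u v by apply: hg => //; lra.
have h2 : G v - G u <= q * (v - u) + eta / 2 * Q u v by apply: hk => //; lra.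
lra.
Qed.

Lemma upper_slope_ip {H : normedModType R} {ip : {dot H for idfun}}
    (ip_norm : induces_norm ip) {f : R -> H} {t : R} {l : H} (c : H) :
  is_derive t 1 f l -> upper_slope Q (fun s => ip c (f s)) t (ip c l).
Proof.
move=> /straddle_derive hf eta eta0; have c1 : 0 < `|c| + 1 by rewrite ltr_wpDl.
have [g g0 hg] := hf _ (divr_gt0 eta0 c1).
exists g => // u v gu ut tv vg; have uv := le_trans ut tv.
have := hg u v gu ut tv vg => h.
have := ip_le ip_norm c (f v - f u - (v - u) *: l); rewrite !ipE.
have : `|c| * `|f v - f u - (v - u) *: l| <= eta * Q u v.
  apply: (@le_trans _ _ ((`|c| + 1) * (eta / (`|c| + 1) * (v - u)))).
    by apply: ler_pM => //; rewrite lerDl.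
  by rewrite mulrA mulrC (mulrC (_ + 1)) divfK ?gt_eqF// mulrC ler_pM2l// Q_ge.
lra.
Qed.

Lemma upper_slope_derive {f : R -> R} {t l : R} :
  is_derive t 1 f l -> upper_slope Q f t l.
Proof.
move=> /straddle_derive hf eta eta0; have [g g0 hg] := hf _ eta0.
exists g => // u v gu ut tv vg; have uv := le_trans ut tv.
have := hg u v gu ut tv vg; rewrite /GRing.scale/= => h.
have := ler_norm (f v - f u - (v - u) * l).
have : eta * (v - u) <= eta * Q u v by rewrite ler_pM2l// Q_ge.
lra.
Qed.

Lemma upper_slopeM {F h : R -> R} {t p l : R} : is_derive t 1 h l -> 0 < h t ->
  F x @[x --> t] --> F t -> upper_slope Q F t p ->
  upper_slope Q (fun s => h s * F s) t (h t * p + l * F t).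
Proof.
move=> dh ht0 cF hF eta eta0.
have ch : h x @[x --> t] --> h t.
  by apply/differentiable_continuous/derivable1_diffP; case: dh.
(* [e * K] bounds the sum of all error terms of the product rule. *)
pose K := 2 * h t + `|p| + `|F t| + `|l| + 2.
have K0 : 0 < K by rewrite ltr_wpDl// !addr_ge0// mulr_ge0// ltW.
pose e := Num.min (Num.min (h t) 1) (eta / K).
have e0 : 0 < e by rewrite !lt_min ht0 ltr01 divr_gt0.
have eh : e <= h t by rewrite !ge_min lexx.
have e1 : e <= 1 by rewrite !ge_min lexx orbT.
have eK : e * K <= eta by rewrite -ler_pdivlMr// !ge_min lexx orbT.
have [g1 g10 hg1] := hF _ e0.
have [g2 g20 hg2] := straddle_derive dh _ e0.
have [g3 g30 hg3] := straddle_continuous ch _ e0.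
have [g4 g40 hg4] := straddle_continuous cF _ e0.
exists (Num.min (Num.min g1 g2) (Num.min g3 g4)) => [|u v].
  by rewrite !lt_min g10 g20 g30.
rewrite !ltrBlDr -!ltrBlDl !lt_min => /andP[/andP[u1 u2] /andP[u3 u4]] ut tv
  /andP[/andP[v1 v2] /andP[v3 v4]].
have uv := le_trans ut tv; have Quv := Q_ge _ _ uv.
have h1 : F v - F u <= p * (v - u) + e * Q u v by apply: hg1; lra.
have h2 : `|h v - h u - (v - u) * l| <= e * (v - u) by apply: hg2; lra.
have h3 : `|h v - h t| <= e by apply: hg3; lra.
have h4 : `|F u - F t| <= e by apply: hg4; lra.
have w0 : 0 <= v - u by rewrite subr_ge0.
have -> : h v * F v - h u * F u = h v * (F v - F u) + F u * (h v - h u) by ring.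
set w := v - u in h1 h2 Quv w0 *; set q := Q u v in h1 Quv *.
have hv0 : 0 <= h v by move: h3; rewrite ler_norml => /andP[? _]; lra.
have hv2 : h v <= 2 * h t by move: h3; rewrite ler_norml => /andP[_ ?]; lra.
have b1 : h v * (F v - F u) <= h t * p * w + e * (`|p| + 2 * h t) * q.
  apply: (le_trans (ler_wpM2l hv0 h1)).
  have : (h v - h t) * p * w <= e * `|p| * w.
    by rewrite ler_wpM2r// (le_trans (ler_norm _))// normrM ler_wpM2r.
  have : e * `|p| * w <= e * `|p| * q.
    by apply: ler_wpM2l => //; apply: mulr_ge0 => //; exact: ltW.
  have : h v * (e * q) <= 2 * h t * (e * q).
    by apply: ler_wpM2r => //; apply: mulr_ge0; [exact: ltW|exact: le_trans Quv].
  lra.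
have b2 : F u * (h v - h u) <= l * F t * w + e * (`|F t| + `|l| + 2) * q.
  set dh' := h v - h u in h2 *.
  have c1 : F t * (dh' - w * l) <= `|F t| * (e * w).
    by rewrite (le_trans (ler_norm _))// normrM ler_wpM2l.
  have c2 : `|dh'| <= (`|l| + 1) * w.
    rewrite -(subrK (w * l) dh'); apply: le_trans (ler_normD _ _) _.
    rewrite normrM (ger0_norm w0).
    have := ler_wpM2r w0 e1; rewrite /GRing.scale/= in h2; lra.
  have c3 : (F u - F t) * dh' <= e * ((`|l| + 1) * w).
    by rewrite (le_trans (ler_norm _))// normrM ler_pM.
  have c4 : e * (`|F t| + `|l| + 2) * w <= e * (`|F t| + `|l| + 2) * q.
    by apply: ler_wpM2l => //; rewrite mulr_ge0 ?(ltW e0)// !addr_ge0.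
  have c5 : 0 <= e * w by rewrite mulr_ge0// ltW.
  lra.
have : e * K * q <= eta * q by apply: ler_wpM2r => //; exact: le_trans Quv.
rewrite /K; lra.
Qed.

(** The slope of [`|f| ^+ 2] at [t] is twice that of the linear function
    [ip (f t) \o f]; differentiability of [f] is not needed, as
    [`|f v - f u|] is dominated by [Q u v]. *)
Lemma upper_slope_sqr_norm {H : normedModType R} {ip : {dot H for idfun}}
    (ip_norm : induces_norm ip) {f : R -> H} {a b t p : R} :
  a < t -> t < b -> lip_interval Q a b f -> f x @[x --> t] --> f t ->
  upper_slope Q (fun s => ip (f t) (f s)) t p ->
  upper_slope Q (fun s => `|f s| ^+ 2) t (2 * p).
Proof.
move=> at_ tb [K hK] cf hF eta eta0.
pose L := 2 * `|K| + 2; have L0 : 0 < L by rewrite ltr_wpDl// mulr_ge0.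
have eL0 : 0 < eta / L by rewrite divr_gt0.
have [g1 g10 hg1] := hF _ eL0.
have [g2 g20 hg2] := straddle_continuous cf _ eL0.
exists (Num.min (Num.min g1 g2) (Num.min (t - a) (b - t))) => [|u v].
  by rewrite !lt_min g10 g20 !subr_gt0 at_.
rewrite !ltrBlDr -!ltrBlDl !lt_min => /andP[/andP[u1 u2] /andP[u3 u4]] ut tv
  /andP[/andP[v1 v2] /andP[v3 v4]].
have uv := le_trans ut tv; have Quv := Q_ge _ _ uv.
have h1 : ip (f t) (f v) - ip (f t) (f u) <= p * (v - u) + eta / L * Q u v.
  by apply: hg1; lra.
have h2 : `|f u - f t| <= eta / L by apply: hg2; lra.
have h3 : `|f v - f t| <= eta / L by apply: hg2; lra.
have q0 : 0 <= Q u v by apply: le_trans Quv; rewrite subr_ge0.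
have h4 : `|f v - f u| <= `|K| * Q u v.
  apply: le_trans (_ : K * Q u v <= _); first by apply: hK; lra.
  by apply: ler_wpM2r => //; exact: ler_norm.
rewrite (sqr_norm_sub ip_norm).
have -> : f v + f u = (f v - f t) + (f u - f t) + 2 *: f t.
  by rewrite scaler_nat mulr2n addrACA !subrK.
rewrite ipDl ipDl ipZl [ip (f t) (_ - _)]ipBr.
have n1 : ip (f v - f t) (f v - f u) <= eta / L * (`|K| * Q u v).
  exact: le_trans (ip_le ip_norm _ _) (ler_pM _ _ _ _).
have n2 : ip (f u - f t) (f v - f u) <= eta / L * (`|K| * Q u v).
  exact: le_trans (ip_le ip_norm _ _) (ler_pM _ _ _ _).
have -> : eta * Q u v = eta / L * L * Q u v by rewrite divfK ?gt_eqF.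
rewrite /L; lra.
Qed.

(** Monotonicity makes the increments of [g] nearly opposite to the velocity
    [- b *: c] of [z], even where [g] has no derivative. *)
Lemma upper_slope_monotone {H : normedModType R} {ip : {dot H for idfun}}
    (ip_norm : induces_norm ip) {z g : R -> H} {t b : R} {c : H} :
  0 < b -> is_derive t 1 z (- b *: c) ->
  (forall u v, 0 <= ip (g v - g u) (z v - z u)) ->
  (forall u v, u <= v -> `|g v - g u| <= Q u v) ->
  upper_slope Q (fun s => ip c (g s)) t 0.
Proof.
move=> b0 /straddle_derive dz gz gQ eta eta0.
have [k k0 hk] := dz _ (mulr_gt0 eta0 b0).
exists k => // u v ku ut tv vk; have uv := le_trans ut tv.
have := hk u v ku ut tv vk; set D := z v - z u - _ => hD.
rewrite mul0r add0r -ipBr; set dg := g v - g u.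
have [uv0|uv0] := eqVneq u v.
  rewrite /dg uv0 subrr -(scale0r (0 : H)) ipZr mul0r mulr_ge0 ?(ltW eta0)//.
  by apply: le_trans (Q_ge _ _ _) => //; rewrite subrr.
have w0 : 0 < v - u by rewrite subr_gt0 lt_neqAle uv0.
have : 0 <= ip dg D + (v - u) * (- b) * ip c dg.
  have := gz u v; rewrite -[z v - z u](subrK ((v - u) *: (- b *: c))) -/D -/dg.
  by rewrite ipDr !ipZr [ip dg c]ipC mulrA.
have := ip_le ip_norm dg D; have := gQ _ _ uv; rewrite -/dg => gQuv.
have : `|dg| * `|D| <= Q u v * (eta * b * (v - u)) by exact: ler_pM.
move=> h1 h2 h3; have {h1 h2 h3} : (v - u) * (b * ip c dg) <= (v - u) * (b * (eta * Q u v)).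
  lra.
by rewrite ler_pM2l// ler_pM2l.
Qed.

End Slopes.
End SlopeCalculus.

(** * Continuously differentiable functions and primitives *)

Section C1.
Context {R : realType}.
Implicit Types (f phi Phi : R -> R) (a b x : R).
Notation mu := (@lebesgue_measure R).

Lemma is_derivative_within_interior {f a x l} : a < x ->
  is_derivative_within `[a, +oo[ f x l -> is_derive x 1 f l.
Proof.
move=> ax fl.
suff : h^-1 *: (f (h *: 1 + x) - f x) @[h --> 0^'] --> l.
  by move=> h; apply: DeriveDef; [apply/cvg_ex; exists l|exact: cvg_lim h].
apply/cvgrPdist_le => e e0; move/cvgrPdist_le : fl => /(_ _ e0).
rewrite !near_withinE => /nbhs_ballP[g /= g0 hg].
apply/nbhs_ballP; exists (Num.min g (x - a)) => /=.
  by rewrite lt_min g0 subr_gt0.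
move=> h; rewrite /ball/= sub0r normrN lt_min => /andP[hg1 hxa] h0.
have hx : h + x != x by rewrite -subr_eq0 addrK.
have bx : ball x g (h + x) by rewrite /ball/= opprD addrCA subrr addr0 normrN.
have ax' : `[a, +oo[%classic (h + x).
  by rewrite /= in_itv/= andbT; move: hxa; rewrite ltr_norml => /andP[? _]; lra.
have := hg _ bx hx ax'.
by rewrite addrK /GRing.scale/= mulr1 [_^-1 * _]mulrC.
Qed.

Lemma is_derivative_within_continuous {f f' a} :
  (forall x, `[a, +oo[%classic x -> is_derivative_within `[a, +oo[ f x (f' x)) ->
  {within `[a, +oo[, continuous f}.
Proof.
move=> fl; apply/subspace_continuousP => x ax; have {}fl := fl x ax.
apply/cvgrPdist_le => e e0; move/cvgrPdist_le : fl => /(_ _ ltr01).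
rewrite !near_withinE => /nbhs_ballP[g /= g0 hg].
have K0 : 0 < `|f' x| + 1 by rewrite ltr_wpDl.
apply/nbhs_ballP; exists (Num.min g (e / (`|f' x| + 1))) => /=.
  by rewrite lt_min g0 divr_gt0.
move=> y; rewrite /ball/= lt_min ltr_pdivlMr// => /andP[yg ye] ay.
have [->|yx] := eqVneq y x; first by rewrite subrr normr0 ltW.
have := hg y yg yx ay; set q := _ / _ => h.
have yx0 : y - x != 0 by rewrite subr_eq0.
rewrite distrC -[f y - f x](divfK yx0) -/q normrM.
apply: le_trans (ltW ye); rewrite mulrC [`|x - y|]distrC ler_wpM2l//.
rewrite -[q](subrK (f' x)) (le_trans (ler_normD _ _))// addrC lerD2l.
by rewrite distrC.
Qed.

Lemma continuous_within_interior {f a x} : a < x ->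
  {within `[a, +oo[, continuous f} -> f y @[y --> x] --> f x.
Proof.
move=> ax /subspace_continuousP/(_ x); rewrite /= in_itv/= andbT => /(_ (ltW ax)).
move=> /cvgrPdist_le h; apply/cvgrPdist_le => e /h.
rewrite near_withinE => /nbhs_ballP[g /= g0 hg].
apply/nbhs_ballP; exists (Num.min g (x - a)) => /=.
  by rewrite lt_min g0 subr_gt0.
move=> y; rewrite /ball/= lt_min => /andP[yg yx]; apply: hg => //.
by rewrite /= in_itv/= andbT; move: yx; rewrite ltr_norml => /andP[_ ?]; lra.
Qed.

Lemma is_derive_continuous {V : normedModType R} {f : R -> V} {x : R} {l : V} :
  is_derive x 1 f l -> f y @[y --> x] --> f x.
Proof. by case=> df _; apply/differentiable_continuous/derivable1_diffP. Qed.

Lemma continuous_after_within {f a} b c : (forall x, a < x -> f y @[y --> x] --> f x) ->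
  a < b -> {within `[b, c], continuous f}.
Proof.
move=> cf ab; apply: continuous_in_subspaceT => x; rewrite inE/= in_itv/=.
move=> /andP[bx _]; exact/cf/(lt_le_trans ab).
Qed.

Lemma C1_lipschitz {f f' : R -> R} {s0 a b} :
  (forall x, s0 < x -> is_derive x 1 f (f' x)) ->
  (forall x, s0 < x -> f' y @[y --> x] --> f' x) -> s0 < a ->
  exists2 K, 0 <= K & forall u v, a <= u -> u <= v -> v <= b ->
    `|f v - f u| <= K * (v - u).
Proof.
move=> df cf' s0a.
have := continuous_compact (continuous_after_within a b cf' s0a)
  (@segment_compact _ a b).
move=> /compact_bounded[K [_ hK]]; exists (`|K| + 1) => [|u v au uv vb].
  by rewrite addr_ge0.
have [||c] := MVT_segment (f := f) (df := f') uv.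
- move=> x; rewrite in_itv/= => /andP[ux _].
  by apply: df; apply: lt_trans ux; exact: lt_le_trans au.
- apply: (continuous_after_within _ _ _ (lt_le_trans s0a au)) => x s0x.
  exact: is_derive_continuous (df _ s0x).
rewrite in_itv/= => /andP[uc cv] ->; rewrite normrM [`|v - u|]ger0_norm ?subr_ge0//.
apply: ler_wpM2r; rewrite ?subr_ge0//; apply: (hK (`|K| + 1)).
  by rewrite (le_lt_trans (ler_norm _))// ltrDl.
exists c => //=; rewrite in_itv/=; apply/andP; split; first exact: le_trans uc.
exact: le_trans vb.
Qed.

(** The primitive is two-sided differentiable at [S] as well: [phi] is
    integrated from [S - 1], with the constant value [phi S] before [S]. *)
Lemma primitive_exists {phi s0} S : (forall x, s0 < x -> phi y @[y --> x] --> phi x) ->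
  s0 < S -> exists Phi, forall s, S <= s -> is_derive s 1 Phi (phi s).
Proof.
move=> cphi s0S; pose g s := phi (Num.max S s).
have cg : continuous g.
  move=> s; apply: (@continuous_comp _ _ _ (Num.max S) phi); last first.
    by apply: cphi; rewrite lt_max s0S.
  apply: (@continuous_max _ _ (cst S) id); [exact: cvg_cst|exact: cvg_id].
exists (fun x => \int[mu]_(t in `[S - 1, x]) g t)%R => s Ss.
have [||||dF F'] := @continuous_FTC1_closed _ g (S - 1) s (s + 1).
- by rewrite ltrDl.
- apply: continuous_compact_integrable; first exact: segment_compact.
  exact: continuous_subspaceT.
- lra.
- exact: cg.
by apply: DeriveDef => //; rewrite -derive1E F' /g max_r.
Qed.

Section Primitive.
Context {s0 S : R} {phi Phi : R -> R}.
Hypothesis cphi : forall x, s0 < x -> phi y @[y --> x] --> phi x.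
Hypothesis s0S : s0 < S.
Hypothesis dPhi : forall s, S <= s -> is_derive s 1 Phi (phi s).
Hypothesis phi_ge0 : forall s, S <= s -> 0 <= phi s.

Let mphi (D : set R) : measurable D -> D `<=` `]s0, +oo[ ->
  measurable_fun D (EFin \o phi).
Proof.
move=> mD Ds; apply/measurable_EFinP.
apply: (@measurable_funS _ _ _ _ `]s0, +oo[%classic) => //.
apply: open_continuous_measurable_fun.
  exact: interval_open.
by move=> x; rewrite inE/= in_itv/= andbT; exact: cphi.
Qed.

Lemma integral_primitive b : S < b ->
  (\int[mu]_(s in `[S, b]) (phi s)%:E = (Phi b - Phi S)%:E)%E.
Proof.
move=> Sb; rewrite (@continuous_FTC2 _ phi Phi)//.
- exact: continuous_after_within cphi s0S.
- split.
  + move=> x; rewrite in_itv/= => /andP[/ltW/dPhi[]//].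
  + apply: cvg_at_right_filter; exact: is_derive_continuous (dPhi _ (lexx S)).
  + apply: cvg_at_left_filter; exact: is_derive_continuous (dPhi _ (ltW Sb)).
- move=> x; rewrite in_itv/= => /andP[/ltW/dPhi[_ <-] _].
  by rewrite derive1E.
Qed.

Lemma primitive_nondecreasing u v : S <= u -> u <= v -> Phi u <= Phi v.
Proof.
move=> Su uv; have [||c] := MVT_segment (f := Phi) (df := phi) uv.
- move=> x; rewrite in_itv/= => /andP[ux _].
  by apply: dPhi; apply: le_trans (ltW ux).
- apply: continuous_in_subspaceT => x; rewrite inE/= in_itv/= => /andP[ux _].
  exact: is_derive_continuous (dPhi _ (le_trans Su ux)).
rewrite in_itv/= => /andP[uc _] h; rewrite -subr_ge0 h mulr_ge0 ?subr_ge0//.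
exact/phi_ge0/(le_trans Su).
Qed.

Lemma primitive_unbounded : (\int[mu]_(s in `[S, +oo[) (phi s)%:E = +oo)%E ->
  forall A, exists2 T, S <= T & forall s, T <= s -> A <= Phi s.
Proof.
move=> intphi A; apply: contrapT => h.
have bd s : S <= s -> Phi s <= A.
  move=> Ss; rewrite leNgt; apply/negP => As; apply: h; exists s => // t st.
  by apply: le_trans (ltW As) _; exact: primitive_nondecreasing.
have : (\int[mu]_(s in `[S, +oo[) (phi s)%:E <= (A - Phi S)%:E)%E.
  rewrite itv_bndy_bigcup_BRight.
  have cv : (\int[mu]_(s in `[S, (S + n%:R)%R]) (phi s)%:E @[n --> \oo] -->
      \int[mu]_(s in \bigcup_n `[S, (S + n%:R)%R]%classic) (phi s)%:E)%E.
    apply: (@ge0_nondecreasing_set_cvg_integral _ (measurableTypeR R)) => //.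
    - move=> m n mn; apply/subsetPset => x /=; rewrite !in_itv/=.
      by move=> /andP[-> /le_trans]; apply; rewrite lerD2l ler_nat.
    - move=> n; apply: mphi => // x; rewrite /= !in_itv/= andbT.
      by move=> /andP[/(lt_le_trans s0S)].
    - by move=> n x; rewrite /= in_itv/= lee_fin => /andP[/phi_ge0].
  rewrite -(cvg_lim _ cv)//; apply: lime_le; first by apply/cvg_ex; eexists; exact: cv.
  apply: nearW => -[|n].
    by rewrite addr0 set_itv1 integral_set1 lee_fin subr_ge0; exact: bd.
  rewrite integral_primitive ?ltrDl// lee_fin lerD2r; apply: bd.
  by rewrite lerDl.
by rewrite intphi leye_eq.
Qed.

Lemma primitive_bounded : (\int[mu]_(s in `[S, +oo[) (phi s)%:E < +oo)%E ->
  exists B, forall s, S <= s -> Phi s <= B.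
Proof.
move=> intphi; set I := integral _ _ _ in intphi.
have I0 : (0 <= I)%E.
  by apply: integral_ge0 => s; rewrite /= in_itv/= andbT lee_fin; exact: phi_ge0.
exists (Phi S + fine I) => s; rewrite le_eqVlt => /predU1P[<-|Ss].
  by rewrite lerDl fine_ge0.
rewrite -lerBlDl -lee_fin fineK ?ge0_fin_numE// -integral_primitive//.
apply: ge0_subset_integral => //.
- apply: mphi => // x; rewrite /= !in_itv/= !andbT; exact: lt_le_trans.
- by move=> x; rewrite /= in_itv/= andbT lee_fin; exact: phi_ge0.
- by move=> x; rewrite /= !in_itv/= andbT => /andP[].
Qed.

End Primitive.
End C1.

(** * Gronwall estimates *)

Section Gronwall.
Context {R : realType} {Q : R -> R -> R}.
Notation mu := (@lebesgue_measure R).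
Hypothesis Q_ge : forall u v, u <= v -> v - u <= Q u v.

Lemma lip_interval_C1 {f f' : R -> R} {s1 a b : R} :
  (forall x, s1 < x -> is_derive x 1 f (f' x)) ->
  (forall x, s1 < x -> f' y @[y --> x] --> f' x) -> s1 < a ->
  lip_interval Q a b f.
Proof.
move=> df cf' s1a; have [K K0 hK] := C1_lipschitz (b := b) df cf' s1a.
exists K => u v au uv vb; apply: le_trans (hK _ _ au uv vb) _.
by rewrite ler_wpM2l ?Q_ge.
Qed.

Context {s1 : R} {delta D : R -> R}.
Hypothesis dD : forall x, s1 < x -> is_derive x 1 D (delta x).
Hypothesis cdelta : forall x, s1 < x -> delta y @[y --> x] --> delta x.

Lemma gronwall {F : R -> R} {S c : R} : s1 < S ->
  (forall b, S <= b -> ac_interval Q S b) ->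
  (forall b, S <= b -> lip_interval Q S b F) ->
  {ae mu, forall t, S < t -> F x @[x --> t] --> F t /\
    upper_slope Q F t (delta t * (c - F t))} ->
  forall s, S <= s -> F s <= c + expR (D S - D s) * (F S - c).
Proof.
move=> s1S acQ lipF aeF s Ss.
have Q0 u v : u <= v -> 0 <= Q u v.
  by move=> uv; apply: le_trans (Q_ge _ _ uv); rewrite subr_ge0.
have dE t : s1 < t -> is_derive t 1 (expR \o D) (expR (D t) * delta t).
  by move=> st; apply: is_derive1_comp; exact: dD.
have cE t : s1 < t -> expR (D y) * delta y @[y --> t] --> expR (D t) * delta t.
  move=> st; apply: cvgM; last exact: cdelta.
  exact: is_derive_continuous (dE _ st).
have : expR (D s) * (F s - c) <= expR (D S) * (F S - c).
  apply: (upper_slope_nonincreasing Q_ge (F := fun s => expR (D s) * (F s - c)) Ss).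
  - exact: acQ.
  - apply: (lip_intervalM Ss Q0 (acQ _ Ss)).
      exact: lip_interval_C1 dE cE s1S.
    exact: lip_intervalD (lipF _ Ss) (lip_interval_cst _).
  - move: aeF; apply: ae_imp => t ht St _; exists 0 => //.
    have [cF sF] := ht St; have st := lt_trans s1S St.
    have sFc : upper_slope Q (fun s => F s - c) t (delta t * (c - F t) + 0).
      exact: upper_slopeD sF (upper_slope_derive Q_ge (is_derive_cst _ _ _)).
    have cFc : F x - c @[x --> t] --> F t - c by apply: cvgB cF (cvg_cst _).
    have := upper_slopeM Q_ge (dE _ st) (expR_gt0 _) cFc sFc.
    by apply: upper_slope_le; rewrite /=; lra.
have Ds := expR_gt0 (D s).
rewrite expRB mulrAC -lerBlDl ler_pdivlMr// mulrC; lra.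
Qed.

Lemma gronwall_limsup {F : R -> R} {S c : R} : s1 < S ->
  (forall A, exists2 T, S <= T & forall s, T <= s -> A <= D s) ->
  (forall b, S <= b -> ac_interval Q S b) ->
  (forall b, S <= b -> lip_interval Q S b F) ->
  {ae mu, forall t, S < t -> F x @[x --> t] --> F t /\
    upper_slope Q F t (delta t * (c - F t))} ->
  forall eta, 0 < eta -> exists2 T, S <= T & forall s, T <= s -> F s <= c + eta.
Proof.
move=> s1S D_oo acQ lipF aeF eta eta0.
pose K := `|F S - c| + 1; have K0 : 0 < K by rewrite ltr_wpDl.
have [T ST hT] := D_oo (D S - ln (eta / K)).
exists T => // s Ts; have Ss := le_trans ST Ts.
apply: le_trans (gronwall s1S acQ lipF aeF s Ss) _; rewrite lerD2l.
have h : expR (D S - D s) <= eta / K.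
  rewrite -[leRHS]lnK ?posrE ?divr_gt0// ler_expR; have := hT _ Ts; lra.
apply: (@le_trans _ _ (eta / K * K)); last by rewrite divfK ?gt_eqF.
apply: le_trans (_ : expR (D S - D s) * K <= _); last by rewrite ler_pM2r.
rewrite ler_wpM2l ?expR_ge0// (le_trans (ler_norm _))// lerDl//.
Qed.

End Gronwall.

(** * Tikhonov regularized trajectories *)

Section Trajectory.
Context {R : realType} {H : completeNormedModType R} {ip : {dot H for idfun}}.
Notation mu := (@lebesgue_measure R).
Hypothesis ip_norm : induces_norm ip.
Context {M : H -> H}.
Hypotheses (M_mono : monotone_operator ip M) (M_cont : continuous M).
Context {s1 S : R} {beta delta eps' D : R -> R} {z : R -> H}.
Hypothesis beta_gt0 : forall s, s1 < s -> 0 < beta s.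
Hypothesis delta_gt0 : forall s, s1 < s -> 0 < delta s.
Hypothesis delta_cont : forall x, s1 < x -> delta y @[y --> x] --> delta x.
(* the Tikhonov parameter *)
Let eps s := delta s / beta s.
Hypothesis eps_derive : forall x, s1 < x -> is_derive x 1 eps (eps' x).
Hypothesis eps'_cont : forall x, s1 < x -> eps' y @[y --> x] --> eps' x.
Hypothesis D_derive : forall x, s1 < x -> is_derive x 1 D (delta x).
Hypothesis D_oo : forall A, exists T, forall s, T <= s -> A <= D s.
Hypothesis s1S : s1 < S.
Hypothesis z_ac : forall b, S <= b -> absolutely_continuous_on S b z.
Hypothesis Mz_ac : forall b, S <= b -> absolutely_continuous_on S b (M \o z).

(** The regularized residual: the equation reads [z' = - beta *: w]. *)
Let w s := M (z s) + eps s *: z s.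

Hypothesis z_ode : {ae mu, forall t, S < t -> is_derive t 1 z (- beta t *: w t)}.

(** The interval function with respect to which all quantities along the
    trajectory are Lipschitz continuous. *)
Let Q u v := `|z v - z u| + `|M (z v) - M (z u)| + (v - u).

Let Q_ge u v : u <= v -> v - u <= Q u v.
Proof. by move=> _; rewrite /Q lerDr addr_ge0. Qed.

Let Q_ge0 u v : u <= v -> 0 <= Q u v.
Proof. by move=> uv; apply: le_trans (Q_ge _ _ uv); rewrite subr_ge0. Qed.

Let Q_ac a b : S <= a -> ac_interval Q a b.
Proof.
move=> Sa; have [Sb|bS] := leP S b; last first.
  move=> e e0; exists 1 => // s hs; have := chain_le hs.
  by rewrite leNgt (lt_le_trans bS).
apply: (ac_interval_sub _ _ Sa (lexx b)); apply: ac_intervalD.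
  by apply: ac_intervalD; apply: ac_interval_increment; [exact: z_ac|exact: Mz_ac].
exact: ac_interval_length.
Qed.

Let z_lip a b : lip_interval Q a b z.
Proof.
by exists 1 => u v _ uv _; rewrite mul1r /Q -addrA lerDl addr_ge0// subr_ge0.
Qed.

Let Mz_le u v : u <= v -> `|M (z v) - M (z u)| <= Q u v.
Proof. by move=> uv; rewrite /Q addrAC lerDr addr_ge0// subr_ge0. Qed.

Let Mz_lip a b : lip_interval Q a b (M \o z).
Proof. by exists 1 => u v _ uv _; rewrite mul1r; exact: Mz_le. Qed.

Let sqr_dist_lip xi a b : S <= a -> a <= b ->
  lip_interval Q a b (fun s => `|z s - xi| ^+ 2).
Proof.
move=> Sa ab; apply: lip_interval_sqr_norm => //; first exact: Q_ac.
by apply: lip_intervalD => //; exact: lip_interval_cst.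
Qed.

Let w_lip a b : S <= a -> a <= b -> lip_interval Q a b w.
Proof.
move=> Sa ab; apply: lip_intervalD (Mz_lip a b) _.
apply: (lip_interval_scale ab Q_ge0 (Q_ac a b Sa) _ (z_lip a b)).
exact: (lip_interval_C1 Q_ge eps_derive eps'_cont (lt_le_trans s1S Sa)).
Qed.

Let sqr_w_lip a b : S <= a -> a <= b -> lip_interval Q a b (fun s => `|w s| ^+ 2).
Proof.
move=> Sa ab; apply: (lip_interval_sqr_norm ab Q_ge0 (Q_ac a b Sa)).
exact: w_lip.
Qed.

(* The increment of [`|z - xi| ^+ 2] is controlled by monotonicity of [M]
   between [z t] and the zero [xi]. *)
Let sqr_dist_slope xi : Zer M xi -> {ae mu, forall t, S < t ->
  `|z x - xi| ^+ 2 @[x --> t] --> `|z t - xi| ^+ 2 /\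
  upper_slope Q (fun s => `|z s - xi| ^+ 2) t
    (- (2 * delta t * ip (z t) (z t - xi)))}.
Proof.
move=> Mxi; move: z_ode; apply: ae_imp => t ht St; have dz := ht St.
have dzx : is_derive t 1 (fun s => z s - xi) (- beta t *: w t).
  by rewrite -[X in is_derive _ _ _ X]subr0; exact: is_deriveB.
have b0 := beta_gt0 _ (lt_trans s1S St).
have czx := is_derive_continuous dzx.
split; first by exact: cvg_sqr_norm czx.
apply: (upper_slope_le (2 * ip (z t - xi) (- beta t *: w t))).
  have := M_mono (z t) xi; rewrite (Mxi : M xi = 0) subr0 => hm.
  have hd : delta t = beta t * eps t.
    by rewrite /eps mulrCA divff ?mulr1// gt_eqF.
  have : 0 <= beta t * ip (M (z t)) (z t - xi) by rewrite mulr_ge0// ltW.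
  rewrite ipZr /w [ip _ (M _ + _)]ipDr [ip _ (eps t *: _)]ipZr hd.
  rewrite [ip (z t - xi) (z t)]ipC [ip (z t - xi) (M _)]ipC.
  lra.
have t1 : t < t + 1 by rewrite ltrDl.
apply: (upper_slope_sqr_norm Q_ge ip_norm St t1) => //.
  by apply: lip_intervalD => //; exact: lip_interval_cst.
exact: (upper_slope_ip Q_ge ip_norm _ dzx).
Qed.

(* The slope of [s |-> ip (w t) (w s)] is the sum of that of
   [s |-> ip (w t) (M (z s))], at most [0] by monotonicity of [M] between nearby
   points of the trajectory, and that of [s |-> eps s * ip (w t) (z s)]. *)
Let sqr_w_slope : {ae mu, forall t, S < t ->
  `|w x| ^+ 2 @[x --> t] --> `|w t| ^+ 2 /\
  upper_slope Q (fun s => `|w s| ^+ 2) t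
    (2 * (`|eps' t| * `|w t| * `|z t| - delta t * `|w t| ^+ 2))}.
Proof.
move: z_ode; apply: ae_imp => t ht St; have dz := ht St.
have st := lt_trans s1S St; have b0 := beta_gt0 _ st.
have cz := is_derive_continuous dz.
have ce := is_derive_continuous (eps_derive _ st).
have cw : w x @[x --> t] --> w t.
  by apply: cvgD; [apply: continuous_cvg => //; exact: M_cont|exact: cvgZ].
split; first by exact: cvg_sqr_norm cw.
apply: (upper_slope_le (2 * (0 + (eps t * ip (w t) (- beta t *: w t) +
    eps' t * ip (w t) (z t))))).
  have hd : delta t = beta t * eps t.
    by rewrite /eps mulrCA divff ?mulr1// gt_eqF.
  have : eps' t * ip (w t) (z t) <= `|eps' t| * `|w t| * `|z t|.
    apply: le_trans (ler_norm _) _; rewrite normrM -mulrA ler_wpM2l//.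
    exact: cauchy_schwarz.
  rewrite ipZr ip_norm hd; lra.
have t1 : t < t + 1 by rewrite ltrDl.
apply: (upper_slope_sqr_norm Q_ge ip_norm St t1) => //.
  exact: w_lip (lexx S) (ltW (lt_trans St t1)).
apply: (@upper_slope_eq _ _
    (fun s => ip (w t) (M (z s)) + eps s * ip (w t) (z s))).
  by move=> s; rewrite /w ipDr ipZr.
apply: upper_slopeD.
  exact: (upper_slope_monotone Q_ge ip_norm b0 dz
    (fun u v => M_mono (z v) (z u)) Mz_le).
apply: (upper_slopeM Q_ge (eps_derive _ st)).
- by rewrite divr_gt0// delta_gt0.
- apply/cvgrPdist_le => e e0; have w1 : 0 < `|w t| + 1 by rewrite ltr_wpDl.
  move/cvgrPdist_le : cz => /(_ _ (divr_gt0 e0 w1)); apply: filterS => s hs.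
  rewrite -ipBr (le_trans (cauchy_schwarz ip_norm _ _))//.
  apply: (@le_trans _ _ ((`|w t| + 1) * (e / (`|w t| + 1)))).
    by apply: ler_pM => //; rewrite lerDl.
  by rewrite mulrC divfK ?gt_eqF.
- exact: (upper_slope_ip Q_ge ip_norm _ dz).
Qed.

Let D_unbounded T A : exists2 T', T <= T' & forall s, T' <= s -> A <= D s.
Proof.
have [T' hT'] := D_oo A; exists (Num.max T T') => [|s].
  by rewrite le_max lexx.
by rewrite ge_max => /andP[_]; exact: hT'.
Qed.

Lemma trajectory_bounded : Zer M !=set0 ->
  exists2 C, 0 <= C & forall s, S <= s -> `|z s| <= C.
Proof.
move=> [xi Mxi]; pose B := `|xi| ^+ 2 + `| `|z S - xi| ^+ 2 - `|xi| ^+ 2|.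
have B0 : 0 <= B by rewrite addr_ge0// exprn_ge0.
have EB s : S <= s -> `|z s - xi| ^+ 2 <= B.
  move=> Ss; apply: le_trans (_ : `|xi| ^+ 2 + expR (D S - D s) *
      (`|z S - xi| ^+ 2 - `|xi| ^+ 2) <= _).
    apply: (gronwall Q_ge D_derive delta_cont (F := fun s => `|z s - xi| ^+ 2) s1S) => //.
    - by move=> b _; exact: Q_ac.
    - by move=> b; exact: sqr_dist_lip.
    - move: (sqr_dist_slope xi Mxi); apply: ae_imp => t ht St.
      have [? sl] := ht St; split => //; move: sl; apply: upper_slope_le.
      have d0 := delta_gt0 _ (lt_trans s1S St).
      have h : `|xi| ^+ 2 - `|z t - xi| ^+ 2 = - (`|z t|^+2 - 2 * ip (z t) xi).
        by rewrite (sqr_normB ip_norm); ring.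
      rewrite h ipBr -ip_norm.
      have : 0 <= delta t * `|z t| ^+ 2 by rewrite mulr_ge0 ?(ltW d0)// exprn_ge0.
      lra.
  rewrite lerD2l (le_trans (ler_norm _))// normrM ler_piMl//.
  rewrite ger0_norm ?expR_ge0// -expR0 ler_expR subr_le0.
  have [||c] := MVT_segment (f := D) (df := delta) Ss.
  - by move=> x; rewrite in_itv/= => /andP[Sx _]; exact/D_derive/(lt_trans s1S).
  - apply: (continuous_after_within _ _ _ s1S) => x s1x.
    exact: is_derive_continuous (D_derive _ s1x).
  rewrite in_itv/= => /andP[Sc _] h; rewrite -subr_ge0 h mulr_ge0 ?subr_ge0//.
  exact/ltW/delta_gt0/(lt_le_trans s1S).
exists (B + 1 + `|xi|) => [|s Ss]; first by rewrite !addr_ge0.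
have -> : z s = (z s - xi) + xi by rewrite subrK.
apply: le_trans (ler_normD _ _) _; rewrite lerD2r.
have := EB _ Ss; have := normr_ge0 (z s - xi); nra.
Qed.

Section Residual.
Context {C : R}.
Hypothesis C_ge0 : 0 <= C.
Hypothesis z_le : forall s, S <= s -> `|z s| <= C.

(** Since [2 * k * C * `|w| <= `|w| ^+ 2 + k ^+ 2 * C ^+ 2], the squared residual
    satisfies [F' <= delta * (k ^+ 2 * C ^+ 2 - F)] once [`|eps'| <= k * delta]. *)
Lemma residual_vanishing_of_ratio :
  (forall k, 0 < k -> exists T, forall s, T <= s -> `|eps' s| <= k * delta s) ->
  forall eta, 0 < eta -> exists T, forall s, T <= s -> `|w s| ^+ 2 <= eta.
Proof.
move=> ratio eta eta0; pose k := Num.min 1 (eta / (2 * (C ^+ 2 + 1))).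
have C1 : 0 < 2 * (C ^+ 2 + 1) by rewrite mulr_gt0// ltr_wpDl// exprn_ge0.
have k0 : 0 < k by rewrite lt_min ltr01 divr_gt0.
have k1 : k <= 1 by rewrite ge_min lexx.
have kC : k * (2 * (C ^+ 2 + 1)) <= eta.
  by rewrite -ler_pdivlMr// ge_min lexx orbT.
have [T' hT'] := ratio _ k0; pose T := Num.max S T'.
have ST : S <= T by rewrite le_max lexx.
suff [T1 _ hT1] : exists2 T1, T <= T1 &
    forall s, T1 <= s -> `|w s| ^+ 2 <= eta / 2 + eta / 2.
  by exists T1 => s /hT1; lra.
apply: (gronwall_limsup Q_ge D_derive delta_cont (F := fun s => `|w s| ^+ 2)).
- exact: lt_le_trans ST.
- exact: D_unbounded.
- by move=> b _; exact: Q_ac.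
- by move=> b; exact: sqr_w_lip.
- move: sqr_w_slope; apply: ae_imp => t ht Tt; have St := le_lt_trans ST Tt.
  have [? sl] := ht St; split => //; move: sl; apply: upper_slope_le.
  have d0 := delta_gt0 _ (lt_trans s1S St).
  have ek : `|eps' t| <= k * delta t.
    by apply: hT'; apply: le_trans (ltW Tt); rewrite le_max lexx orbT.
  have h : `|eps' t| * `|w t| * `|z t| <= k * delta t * `|w t| * C.
    by apply: ler_pM; rewrite ?mulr_ge0 ?z_le ?ler_wpM2r// ltW.
  have h1 : 2 * (k * C * `|w t|) <= `|w t| ^+ 2 + eta / 2.
    have : k ^+ 2 * C ^+ 2 <= eta / 2.
      have : k * C ^+ 2 <= eta / 2.
        have : 0 <= k by exact: ltW.
        lra.
      apply: le_trans; rewrite ler_wpM2r ?exprn_ge0// expr2 ler_piMl// ltW//.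
    have := sqr_ge0 (k * C - `|w t|); rewrite sqrrB exprMn; lra.
  have := ler_wpM2l (ltW d0) h1; lra.
- by rewrite divr_gt0.
Qed.

(** [P] is a primitive of [`|eps'|]; its boundedness says that [eps] has finite
    total variation. *)
Lemma residual_vanishing_of_variation (P : R -> R) :
  (forall x, s1 < x -> is_derive x 1 P `|eps' x|) ->
  (exists B, forall s, S <= s -> P s <= B) ->
  forall eta, 0 < eta -> exists T, forall s, T <= s -> `|w s| ^+ 2 <= eta.
Proof.
move=> dP [B hB] eta eta0.
have ceps x : s1 < x -> `|eps' y| @[y --> x] --> `|eps' x|.
  by move=> sx; apply: cvg_norm; exact: eps'_cont.
have Pmono u v : S <= u -> u <= v -> P u <= P v.
  move=> Su; apply: (primitive_nondecreasing (phi := fun s => `|eps' s|) (S := S)) => //.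
  by move=> s Ss; apply: dP; exact: lt_le_trans Ss.
(* the variation of [eps] beyond [T] tends to [0] *)
have tail e : 0 < e -> exists2 T, S <= T & forall s, T <= s -> P s - P T <= e.
  move=> e0; pose A := [set P s | s in `[S, +oo[].
  have supA : has_sup A.
    split; first by exists (P S), S => //=; rewrite in_itv/= lexx.
    by exists B => _ [s + <-]; rewrite /= in_itv/= andbT; exact: hB.
  have [_ [T + <-]] := sup_adherent e0 supA; rewrite /= in_itv/= andbT => ST hT.
  exists T => // s Ts; have : P s <= sup A.
    apply: (sup_upper_bound supA); exists s => //=.
    by rewrite in_itv/= andbT (le_trans ST).
  lra.
(* The integrating factor [a] turns [2 * `|eps'| * C * `|w|], which is at most
   [`|eps'| * (`|w| ^+ 2 + C ^+ 2)], into one that does not involve [w] and is at most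
   the derivative of [C ^+ 2 * P]; [Y] subtracts [C ^+ 2 * P] as well. *)
pose m := expR (P S - B); have m0 : 0 < m by exact: expR_gt0.
pose a s := expR (P S - P s).
have am s : S <= s -> m <= a s by move=> Ss; rewrite ler_expR lerD2l lerN2 hB.
have a1 s : S <= s -> a s <= 1.
  by move=> Ss; rewrite -expR0 ler_expR subr_le0 Pmono.
have da t : s1 < t -> is_derive t 1 a (a t * - `|eps' t|).
  move=> st; apply: is_derive1_comp.
  rewrite -[X in is_derive _ _ _ X]add0r; apply: is_deriveB; exact: dP.
have ca t : s1 < t -> a y * - `|eps' y| @[y --> t] --> a t * - `|eps' t|.
  move=> st; apply: cvgM; first exact: is_derive_continuous (da _ st).
  by apply: cvgN; exact: ceps.
have C1 : 0 < 2 * (C ^+ 2 + 1) by rewrite mulr_gt0// ltr_wpDl// exprn_ge0.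
have me0 : 0 < m * eta by rewrite mulr_gt0.
have [T ST hT] := tail _ (divr_gt0 me0 C1).
have sT := lt_le_trans s1S ST.
pose Y s := a s * `|w s| ^+ 2 + - (C ^+ 2) * (P s - P T).
have P_lip b : lip_interval Q T b P by exact: (lip_interval_C1 Q_ge dP ceps sT).
suff [T1 TT1 hT1] : exists2 T1, T <= T1 &
    forall s, T1 <= s -> Y s <= 0 + m * eta / 2.
  exists T1 => s Ts1; have Ts := le_trans TT1 Ts1; have Ss := le_trans ST Ts.
  have Ys := hT1 _ Ts1.
  have h1 : C ^+ 2 * (P s - P T) <= m * eta / 2.
    have := hT _ Ts; rewrite ler_pdivlMr// => h.
    have : 0 <= P s - P T by rewrite subr_ge0 Pmono.
    lra.
  have h2 : m * `|w s| ^+ 2 <= a s * `|w s| ^+ 2.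
    by rewrite ler_wpM2r ?exprn_ge0// am.
  rewrite -(ler_pM2l m0); move: Ys; rewrite /Y; lra.
apply: (gronwall_limsup Q_ge D_derive delta_cont (F := Y) sT).
- exact: D_unbounded.
- by move=> b _; exact: Q_ac.
- move=> b Tb; have acQ := Q_ac T b ST; apply: lip_intervalD.
    apply: (lip_intervalM Tb Q_ge0 acQ) (sqr_w_lip _ _ ST Tb).
    exact: (lip_interval_C1 Q_ge da ca sT).
  apply: (lip_intervalM Tb Q_ge0 acQ); first exact: lip_interval_cst.
  by apply: lip_intervalD => //; exact: lip_interval_cst.
- move: sqr_w_slope; apply: ae_imp => t ht Tt; have St := le_lt_trans ST Tt.
  have [cw sl] := ht St; have st := lt_trans s1S St.
  have dPT : is_derive t 1 (fun s => - (C ^+ 2) * (P s - P T))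
      (- (C ^+ 2) * `|eps' t|).
    have h : is_derive t 1 (fun s => P s - P T) `|eps' t|.
      by rewrite -[X in is_derive _ _ _ X]subr0; apply: is_deriveB; exact: dP.
    exact: is_deriveZ.
  split.
    apply: cvgD; last exact: is_derive_continuous dPT.
    by apply: cvgM => //; exact: is_derive_continuous (da _ st).
  have := upper_slopeD (upper_slopeM Q_ge (da _ st) (expR_gt0 _) cw sl)
    (upper_slope_derive Q_ge dPT).
  apply: upper_slope_le.
  have d0 := delta_gt0 _ st; rewrite sub0r.
  have h1 : 2 * (`|w t| * `|z t|) <= `|w t| ^+ 2 + C ^+ 2.
    have h : `|w t| * `|z t| <= `|w t| * C by rewrite ler_wpM2l// z_le// ltW.
    have := sqr_ge0 (C - `|w t|); rewrite sqrrB; lra.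
  have a0 : 0 < a t by exact: expR_gt0.
  have a1t := a1 t (ltW St).
  have h2 : a t * `|eps' t| * (2 * (`|w t| * `|z t|)) <=
      a t * `|eps' t| * (`|w t| ^+ 2 + C ^+ 2).
    by rewrite ler_wpM2l// mulr_ge0// ltW.
  have h3 : a t * (`|eps' t| * C ^+ 2) <= `|eps' t| * C ^+ 2.
    by rewrite ler_piMl// mulr_ge0// exprn_ge0.
  have h4 : 0 <= delta t * (a t * `|w t| ^+ 2).
    by rewrite !mulr_ge0 ?exprn_ge0// ltW.
  have h5 : 0 <= delta t * (C ^+ 2 * (P t - P T)).
    by rewrite !mulr_ge0 ?exprn_ge0 ?subr_ge0 ?Pmono// ltW.
  rewrite /Y; lra.
- by rewrite divr_gt0.
Qed.

End Residual.

Lemma trajectory_cvg C xi :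
  (forall k, 0 < k -> exists T, forall s, T <= s -> eps s <= k) ->
  0 <= C -> (forall s, S <= s -> `|z s| <= C) -> Zer M xi ->
  (forall eta : R, 0 < eta -> exists2 m : R, 0 < m &
      forall x, `|x| <= C -> `|M x| <= m -> - eta <= ip xi (x - xi)) ->
  (forall eta, 0 < eta -> exists T, forall s, T <= s -> `|w s| ^+ 2 <= eta) ->
  z s @[s --> +oo] --> xi.
Proof.
move=> eps_cvg0 C0 z_le Mxi hxi w_cvg0.
suff lim eta : 0 < eta -> exists T, forall s, T <= s -> `|z s - xi| ^+ 2 <= eta.
  apply/cvgrPdist_le => e e0; have [T hT] := lim _ (exprn_gt0 2 e0).
  exists T; split; first exact: num_real.
  move=> s Ts; rewrite distrC -(@ler_pXn2r _ 2) ?nnegrE ?(ltW e0)//.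
  exact/hT/ltW.
move=> eta0; have eta4 : 0 < eta / 4 by rewrite divr_gt0.
have [m m0 hm] := hxi _ eta4.
have m2 : 0 < m / 2 by rewrite divr_gt0.
have C1 : 0 < C + 1 by rewrite ltr_wpDl.
have [T1 hT1] := w_cvg0 _ (exprn_gt0 2 m2).
have [T2 hT2] := eps_cvg0 _ (divr_gt0 m2 C1).
pose T := Num.max S (Num.max T1 T2).
have ST : S <= T by rewrite le_max lexx.
have ip_ge s : T <= s -> - (eta / 4) <= ip xi (z s - xi).
  rewrite !ge_max => /and3P[Ss T1s T2s]; apply: hm; first exact: z_le.
  have -> : M (z s) = w s - eps s *: z s by rewrite /w addrK.
  apply: le_trans (ler_normB _ _) _.
  have h1 : `|w s| <= m / 2.
    by rewrite -(@ler_pXn2r _ 2) ?nnegrE ?(ltW m2)// hT1.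
  have s1s := lt_le_trans s1S Ss.
  have e0 : 0 < eps s by rewrite divr_gt0 ?delta_gt0 ?beta_gt0.
  have h2 : eps s * `|z s| <= m / 2.
    apply: (@le_trans _ _ (m / 2 / (C + 1) * (C + 1))); last first.
      by rewrite divfK ?gt_eqF.
    apply: ler_pM; rewrite ?(ltW e0) ?hT2//.
    by apply: le_trans (z_le _ Ss) _; rewrite lerDl.
  rewrite normrZ (gtr0_norm e0); lra.
suff [T3 _ hT3] : exists2 T3, T <= T3 &
    forall s, T3 <= s -> `|z s - xi| ^+ 2 <= eta / 2 + eta / 2.
  by exists T3 => s /hT3; lra.
apply: (gronwall_limsup Q_ge D_derive delta_cont
  (F := fun s => `|z s - xi| ^+ 2)).
- exact: lt_le_trans ST.
- exact: D_unbounded.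
- by move=> b _; exact: Q_ac.
- by move=> b; exact: sqr_dist_lip.
- move: (sqr_dist_slope xi Mxi); apply: ae_imp => t ht Tt.
  have St := le_lt_trans ST Tt.
  have [? sl] := ht St; split => //; move: sl; apply: upper_slope_le.
  have d0 := delta_gt0 _ (lt_trans s1S St).
  have hE : ip (z t) (z t - xi) = `|z t - xi| ^+ 2 + ip xi (z t - xi).
    by rewrite ip_norm -ipDl subrK.
  rewrite hE; have := ler_wpM2l (ltW d0) (ip_ge _ (ltW Tt)).
  have : 0 <= delta t * `|z t - xi| ^+ 2 by rewrite mulr_ge0 ?(ltW d0) ?exprn_ge0.
  lra.
- by rewrite divr_gt0.
Qed.

Lemma regularized_trajectory_cvg :
  Zer M !=set0 ->
  (forall k, 0 < k -> exists T, forall s, T <= s -> eps s <= k) ->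
  (exists2 P : R -> R, forall x, s1 < x -> is_derive x 1 P `|eps' x| &
      exists B, forall s, S <= s -> P s <= B) \/
  (forall k, 0 < k -> exists T, forall s, T <= s -> `|eps' s| <= k * delta s) ->
  exists2 xi, nearest_point (Zer M) 0 xi & z s @[s --> +oo] --> xi.
Proof.
move=> M0 eps_cvg0 eps'_cond; have [C C0 zC] := trajectory_bounded M0.
have [xi [xi_min hxi]] := min_norm_zero ip_norm M M_mono M_cont C C0 M0.
exists xi => //; apply: (trajectory_cvg C) => //; first by case: xi_min.
case: eps'_cond => [[P dP P_le]|ratio].
  exact: residual_vanishing_of_variation C0 zC P dP P_le.
exact: residual_vanishing_of_ratio C0 zC ratio.
Qed.

End Trajectory.

(** * Integrals over half-lines *)

Lemma absolutely_continuous_on_sub {R : realType} {V : normedModType R}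
    {f : R -> V} {a b : R} (a' : R) : a <= a' ->
  absolutely_continuous_on a b f -> absolutely_continuous_on a' b f.
Proof.
move=> aa hf e /hf[d d0 hd]; exists d => // n u v huv; apply: hd => i.
by have [au uv vb] := huv i; split => //; exact: le_trans au.
Qed.

Lemma cvg0_pinfty {R : realType} {f : R -> R} : f s @[s --> +oo] --> 0 ->
  forall k, 0 < k -> exists T, forall s, T <= s -> `|f s| <= k.
Proof.
move=> /cvgrPdist_le h k /h[A [_ hA]]; exists (A + 1) => s As.
by have := hA s; rewrite sub0r normrN; apply; rewrite (lt_le_trans _ As)// ltrDl.
Qed.

Lemma metric_projection_Zer {R : realType} {H : completeNormedModType R}
    {ip : {dot H for idfun}} (ip_norm : induces_norm ip) {M : H -> H}
    (M_mono : monotone_operator ip M) (M_cont : continuous M) {xi : H} :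
  nearest_point (Zer M) 0 xi -> metric_projection (Zer M) 0 = xi.
Proof.
move=> hxi; apply: (eq_nearest_point ip_norm (Zer M)) => //; last first.
  by rewrite /metric_projection; apply: (@getPex _ (nearest_point (Zer M) 0)); exists xi.
move=> x y Mx My; apply: (almost_zeros_Zer ip_norm M M_cont 0 _ (lexx 0)) => mu mu0.
have -> : 2^-1 *: (x + y) = x + 2^-1 *: (y - x).
  rewrite scalerBr scalerDr addrA addrAC; congr (_ + _).
  rewrite -[X in X - _]scale1r -scalerBl; congr (_ *: _); lra.
apply: almost_zeros_convex; first by rewrite invr_ge0 ler0n invf_le1// ler1n.
  by apply: (Zer_almost_zeros M M_mono) => //; exact: ltW.
by apply: (Zer_almost_zeros M M_mono) => //; exact: ltW.
Qed.

Section HalfLineIntegrals.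
Context {R : realType} {s0 s1 : R}.
Notation mu := (@lebesgue_measure R).
Hypothesis s01 : s0 < s1.

Lemma integral_tail_infinite (f : R -> R) : {within `[s0, +oo[, continuous f} ->
  (forall s, s0 <= s -> 0 <= f s) ->
  (\int[mu]_(s in `[s0, +oo[) (f s)%:E = +oo)%E ->
  (\int[mu]_(s in `[s1, +oo[) (f s)%:E = +oo)%E.
Proof.
move=> cf f0; have mf : measurable_fun `[s0, +oo[ (EFin \o f).
  by apply/measurable_EFinP; apply: subspace_continuous_measurable_fun.
rewrite (@itv_bndbnd_setU _ _ _ (BLeft s1)) ?bnd_simp ?ltW//.
rewrite ge0_integral_setU//=; first last.
- apply/disj_setPS => x [] /=; rewrite !in_itv/= andbT => /andP[_ xs].
  by rewrite leNgt xs.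
- move=> x [] /=; rewrite in_itv/= => /andP[? ?]; rewrite lee_fin f0//.
  exact: le_trans (ltW s01) _.
- by rewrite -itv_bndbnd_setU ?bnd_simp ?ltW.
move=> hoo; have fin : (\int[mu]_(s in `[s0, s1[) (f s)%:E < +oo)%E.
  apply: (@le_lt_trans _ _ (\int[mu]_(s in `[s0, s1]) (f s)%:E)%E).
    apply: ge0_subset_integral => //.
    - apply: measurable_funS mf => // x /=; rewrite !in_itv/= andbT.
      by move=> /andP[].
    - by move=> x /=; rewrite in_itv/= lee_fin => /andP[/f0].
    - by move=> x /=; rewrite !in_itv/= => /andP[-> /ltW].
  have : mu.-integrable `[s0, s1] (EFin \o f).
    apply: continuous_compact_integrable; first exact: segment_compact.
    apply: continuous_subspaceW cf => x /=; rewrite !in_itv/= andbT.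
    by move=> /andP[].
  move=> /integrableP[_]; apply: le_lt_trans; apply: ge0_le_integral => //.
  - by move=> x /=; rewrite in_itv/= lee_fin => /andP[/f0].
  - apply: measurable_funS mf => // x /=; rewrite !in_itv/= andbT.
    by move=> /andP[].
  - by apply: measurableT_comp => //; apply: measurable_funS mf => // x /=;
      rewrite !in_itv/= andbT => /andP[].
  - by move=> x _ /=; rewrite lee_fin ler_norm.
have fin0 : (0 <= \int[mu]_(s in `[s0, s1[) (f s)%:E)%E.
  by apply: integral_ge0 => x /=; rewrite in_itv/= lee_fin => /andP[/f0].
have ffin : (\int[mu]_(s in `[s0, s1[) (f s)%:E)%E \is a fin_num.
  by rewrite ge0_fin_numE.
move: hoo; rewrite -(fineK ffin); by case: (\int[mu]_(s in `[s1, +oo[) (f s)%:E)%E.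
Qed.

(** The functions [f] and [phi] agree after [s0]; the value of [f] at [s0] is
    irrelevant. *)
Lemma integral_tail_finite (f phi : R -> R) :
  (forall x, s0 < x -> phi y @[y --> x] --> phi x) ->
  (forall x, s0 < x -> f x = phi x) ->
  (forall s, 0 <= f s) ->
  (\int[mu]_(s in `[s0, +oo[) (f s)%:E < +oo)%E ->
  (\int[mu]_(s in `[s1, +oo[) (phi s)%:E < +oo)%E.
Proof.
move=> cphi fE f0; apply: le_lt_trans.
have -> : (\int[mu]_(s in `[s1, +oo[) (phi s)%:E =
    \int[mu]_(s in `[s1, +oo[) (f s)%:E)%E.
  apply: eq_integral => s; rewrite inE/= in_itv/= andbT => ss.
  by rewrite fE// (lt_le_trans s01).
have mf : measurable_fun (`[s0, +oo[%classic : set R) (EFin \o f).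
  apply/measurable_EFinP.
  have -> : `[s0, +oo[%classic = [set s0] `|` `]s0, +oo[%classic :> set R.
    by rewrite setU1itv.
  apply/measurable_funU => //; split; first exact: measurable_fun_set1.
  apply: (eq_measurable_fun phi).
    by move=> x; rewrite inE/= in_itv/= andbT => /fE.
  apply: open_continuous_measurable_fun; first exact: interval_open.
  by move=> x; rewrite inE/= in_itv/= andbT; exact: cphi.
apply: ge0_subset_integral => //.
- by move=> x _; rewrite lee_fin.
- move=> x /=; rewrite !in_itv/= !andbT; exact/le_trans/ltW.
Qed.

End HalfLineIntegrals.

(** * Strong convergence to the minimum norm solution *)

Theorem theorem2p14 (R : realType) (H : completeNormedModType R)
    (ip : {dot H for idfun}) (ip_norm : induces_norm ip)
    (M : H -> H) (M_mono : monotone_operator ip M) (M_cont : continuous M)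
    (Zer_neq0 : Zer M !=set0)
    (s0 : R) (s0_ge0 : 0 <= s0) (z0 : H) (beta delta : R -> R)
    (beta_gt0 : forall s, s0 <= s -> 0 < beta s)
    (delta_gt0 : forall s, s0 <= s -> 0 < delta s)
    (beta_C1 : continuously_differentiable_on `[s0, +oo[ beta)
    (delta_C1 : continuously_differentiable_on `[s0, +oo[ delta)
    (delta_beta_cvg0 : delta s / beta s @[s --> +oo] --> 0)
    (int_delta : (\int[lebesgue_measure]_(s in `[s0, +oo[) (delta s)%:E = +oo)%E)
    (int_beta : (\int[lebesgue_measure]_(s in `[s0, +oo[) (beta s)%:E = +oo)%E)
    (z : R -> H) (z_sol : trajectory_solution M beta delta s0 z0 z)
    (beta_delta_cond :
      (\int[lebesgue_measure]_(s in `[s0, +oo[)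
         (`|(fun t => delta t / beta t)^`()%classic s|)%:E < +oo)%E
      \/
      (beta s)^-1 * `|delta^`()%classic s / delta s - beta^`()%classic s / beta s|
        @[s --> +oo] --> 0) :
  z s @[s --> +oo] --> metric_projection (Zer M) 0.
Proof.
have [b' [b'_cont b'_der]] := beta_C1; have [d' [d'_cont d'_der]] := delta_C1.
have after_s0 s : s0 < s -> `[s0, +oo[%classic s.
  by move=> ss; rewrite /= in_itv/= andbT ltW.
have dbeta s : s0 < s -> is_derive s 1 beta (b' s).
  by move=> ss; apply: is_derivative_within_interior ss (b'_der _ (after_s0 _ ss)).
have ddelta s : s0 < s -> is_derive s 1 delta (d' s).
  by move=> ss; apply: is_derivative_within_interior ss (d'_der _ (after_s0 _ ss)).
have cb' s : s0 < s -> b' y @[y --> s] --> b' s.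
  by move=> ss; exact: continuous_within_interior ss b'_cont.
have cd' s : s0 < s -> d' y @[y --> s] --> d' s.
  by move=> ss; exact: continuous_within_interior ss d'_cont.
have b0 s : s0 < s -> 0 < beta s by move=> /ltW; exact: beta_gt0.
have d0 s : s0 < s -> 0 < delta s by move=> /ltW; exact: delta_gt0.
have cbeta s (ss : s0 < s) := is_derive_continuous (dbeta s ss).
have cdelta s (ss : s0 < s) := is_derive_continuous (ddelta s ss).
pose eps' s := delta s * (- beta s ^- 2 * b' s) + (beta s)^-1 * d' s.
have deps s : s0 < s -> is_derive s 1 (fun t => delta t / beta t) (eps' s).
  move=> ss; have bs0 : beta s != 0 by rewrite gt_eqF ?b0.
  exact: is_deriveM (ddelta s ss) (is_deriveV bs0 (dbeta s ss)).
have cVbeta s : s0 < s -> (beta y)^-1 @[y --> s] --> (beta s)^-1.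
  by move=> ss; apply: cvgV; [rewrite gt_eqF ?b0|exact: cbeta].
have ceps' s : s0 < s -> eps' y @[y --> s] --> eps' s.
  move=> ss; apply: cvgD; last by apply: cvgM; [exact: cVbeta|exact: cd'].
  apply: cvgM; first exact: cdelta.
  apply: cvgM; last exact: cb'.
  apply: cvgN; apply: cvgV; first by rewrite expf_neq0// gt_eqF ?b0.
  by under eq_cvg do rewrite expr2; rewrite expr2; apply: cvgM; exact: cbeta.
(* The primitives below are two-sided differentiable from [s1] on. *)
pose s1 := s0 + 1; pose S := s0 + 2.
have s01 : s0 < s1 by rewrite ltrDl.
have s1S : s1 < S by rewrite ltrD2l ltr1n.
have s0S : s0 <= S by rewrite ltW// (lt_trans s01).
have after s : s1 < s -> s0 < s by exact: lt_trans.
have [D dD] := primitive_exists s1 cdelta s01.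
have D_oo A : exists T, forall s, T <= s -> A <= D s.
  have [||T _ hT] := primitive_unbounded cdelta s01 dD _ _ A.
  - by move=> s ss; exact/ltW/d0/(lt_le_trans s01).
  - apply: (integral_tail_infinite s01) int_delta.
      exact: is_derivative_within_continuous d'_der.
    by move=> s ss; exact/ltW/delta_gt0.
  - by exists T.
have [[z_ac Mz_ac z_ae _] _] := z_sol.
have z_acS b : S <= b -> absolutely_continuous_on S b z.
  move=> Sb; apply: (absolutely_continuous_on_sub _ s0S).
  exact/z_ac/(le_trans s0S).
have Mz_acS b : S <= b -> absolutely_continuous_on S b (M \o z).
  move=> Sb; apply: (absolutely_continuous_on_sub _ s0S).
  exact/Mz_ac/(le_trans s0S).
have z_ode : {ae lebesgue_measure, forall t, S < t ->
    is_derive t 1 z (- beta t *: (M (z t) + (delta t / beta t) *: z t))}.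
  move: z_ae; apply: ae_imp => t ht St.
  have s0t : s0 < t := le_lt_trans s0S St.
  have [dz hz] := ht (ltW s0t); apply: DeriveDef => //; rewrite -derive1E.
  apply/eqP; rewrite scaleNr -addr_eq0 scalerDr scalerA mulrCA divff ?mulr1.
    by rewrite addrA; apply/eqP.
  by rewrite gt_eqF// b0.
suff [xi /(metric_projection_Zer ip_norm M_mono M_cont) ->] :
  exists2 xi, nearest_point (Zer M) 0 xi & z s @[s --> +oo] --> xi by [].
have dD1 s : s1 < s -> is_derive s 1 D (delta s) by move=> /ltW; exact: dD.
apply: (regularized_trajectory_cvg ip_norm M_mono M_cont (beta := beta)
  (delta := delta) (eps' := eps') _ _ _ _ _ dD1 D_oo s1S) => //.
- by move=> s /after; exact: b0.
- by move=> s /after; exact: d0.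
- by move=> s /after; exact: cdelta.
- by move=> s /after; exact: deps.
- by move=> s /after; exact: ceps'.
- move=> k /(cvg0_pinfty delta_beta_cvg0)[T hT]; exists T => s /hT.
  exact: le_trans (ler_norm _).
case: beta_delta_cond => [eps_var|ratio].
- have cabs s : s0 < s -> `|eps' y| @[y --> s] --> `|eps' s|.
    by move=> ss; apply: cvg_norm; exact: ceps'.
  have [P dP] := primitive_exists s1 cabs s01.
  left; exists P; first by move=> s /ltW; exact: dP.
  have [||B hB] := primitive_bounded cabs s01 dP.
  + by [].
  + apply: (integral_tail_finite s01 _ _ cabs _ _ eps_var) => // s ss.
    by rewrite derive1E; have [_ ->] := deps s ss.
  + by exists B => s Ss; apply: hB; exact: le_trans (ltW s1S) Ss.
- right=> k /(cvg0_pinfty ratio)[T hT]; exists (Num.max T s1) => s.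
  rewrite ge_max => /andP[/hT + ss1]; have ss : s0 < s := lt_le_trans s01 ss1.
  rewrite !derive1E; have [_ ->] := ddelta s ss; have [_ ->] := dbeta s ss.
  have bs := b0 s ss; have ds := d0 s ss.
  have -> : eps' s = delta s * ((beta s)^-1 * (d' s / delta s - b' s / beta s)).
    by rewrite /eps'; field; rewrite !gt_eqF.
  rewrite !normrM normr_id (gtr0_norm ds) => h.
  by rewrite [leRHS]mulrC ler_pM2l.
Qed.
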